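(* Let $\Gamma<\mathrm{PSL}_2(\mathbb{C})$ be a torsion-free geometrically finite Kleinian group whose limit set $\Lambda$ is a circle packing. Let $k\ge3$ be an integer and let $\mathcal{B}_k$ denote the set of circles $C\subset\mathbb{S}^2$ such that $|C\cap\Lambda|=k$. Then $\mathcal{B}_k$ is a discrete $\Gamma$-invariant set. Moreover, if a circle $C$ with $|C\cap\Lambda|<\infty$ is an accumulation point of $\mathcal{B}_k$, then $|C\cap\Lambda|<k$.
   Context: A Kleinian group is a discrete subgroup of $G=\mathrm{PSL}_2(\mathbb{C})\cong\mathrm{Isom}^+(\mathbb{H}^3)$; it is geometrically finite if its action on $\mathbb{H}^3$ admits a finite-sided fundamental domain. Its limit set is $\Lambda=\overline{\Gamma o}\cap\partial\mathbb{H}^3$ for any $o\in\mathbb{H}^3$, where $\partial\mathbb{H}^3\cong\mathbb{S}^2$. $\Lambda$ is a circle packing if it is the complement of countably infinitely many open round disks in $\mathbb{S}^2$, these disks being the connected components of $\mathbb{S}^2\setminus\Lambda$. $\mathcal{C}$ denotes the space of (round, non-degenerate) circles in $\mathbb{S}^2$, identified with $G/\mathrm{PGL}_2(\mathbb{R})$ and given the quotient topology; $\Gamma$ acts on it through its conformal action on $\mathbb{S}^2$. ''Discrete'' means discrete in the subspace topology from $\mathcal{C}$ (no element of $\mathcal{B}_k$ is a limit of other elements of $\mathcal{B}_k$). A circle $C\in\mathcal{C}$ is an accumulation point of $\mathcal{B}_k$ if it is the limit in $\mathcal{C}$ of a sequence of elements of $\mathcal{B}_k$ different from $C$. *)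

(* Defs.v *)
From HB Require Import structures.
From mathcomp Require Import all_boot all_order all_algebra.
From mathcomp Require Import ring lra complex.
From mathcomp Require Import all_classical all_reals all_analysis.

Set Implicit Arguments.
Unset Strict Implicit.
Unset Printing Implicit Defensive.

Import Order.TTheory GRing.Theory Num.Theory.
Import numFieldNormedType.Exports.

Local Open Scope classical_set_scope.
Local Open Scope ring_scope.
Local Open Scope complex_scope.
Local Open Scope quotient_scope.

(* The norm topology of R[i], which the library only provides on R[i]^o. *)
HB.instance Definition _ (R : realType) := PseudoPointedMetric.copy R[i] R[i]^o.
HB.instance Definition _ (R : realType) := NormedModule.copy R[i] R[i]^o.

Definition SL2 (R : realType) : Type :=
  set_type [set A : 'M[R[i]]_2 | \det A = 1].

HB.instance Definition _ (R : realType) := Choice.on (SL2 R).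
HB.instance Definition _ (R : realType) := Topological.on (SL2 R).

Section SL2Group.
Variable R : realType.
Implicit Types A B : SL2 R.

Definition SL2mx A : 'M[R[i]]_2 := \val A.

Lemma SL2_det A : \det (SL2mx A) = 1.
Proof. exact: set_mem (valP A). Qed.

Lemma SL2_unit A : SL2mx A \in unitmx.
Proof. by rewrite unitmxE SL2_det unitr1. Qed.

Definition mkSL2 (M : 'M[R[i]]_2) (h : \det M = 1) : SL2 R :=
  exist _ M (mem_set h).

Lemma SL2mx_inj : injective SL2mx.
Proof. exact: val_inj. Qed.

Fact SL2_one_det : \det (1%:M : 'M[R[i]]_2) = 1.
Proof. exact: det1. Qed.

Fact SL2_mul_det A B : \det (SL2mx A *m SL2mx B) = 1.
Proof. by rewrite det_mulmx !SL2_det mulr1. Qed.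

Fact SL2_inv_det A : \det (invmx (SL2mx A)) = 1.
Proof. by rewrite det_inv SL2_det invr1. Qed.

Definition SL2_one : SL2 R := mkSL2 SL2_one_det.
Definition SL2_mul A B : SL2 R := mkSL2 (SL2_mul_det A B).
Definition SL2_inv A : SL2 R := mkSL2 (SL2_inv_det A).

Lemma SL2mxM A B : SL2mx (SL2_mul A B) = SL2mx A *m SL2mx B. Proof. by []. Qed.
Lemma SL2mxV A : SL2mx (SL2_inv A) = invmx (SL2mx A). Proof. by []. Qed.

Fact SL2_mulA : associative SL2_mul.
Proof. by move=> A B D; apply: SL2mx_inj; exact: mulmxA. Qed.
Fact SL2_mul1 : left_id SL2_one SL2_mul.
Proof. by move=> A; apply: SL2mx_inj; exact: mul1mx. Qed.
Fact SL2_1mul : right_id SL2_one SL2_mul.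
Proof. by move=> A; apply: SL2mx_inj; exact: mulmx1. Qed.
Fact SL2_mulV : left_inverse SL2_one SL2_inv SL2_mul.
Proof. by move=> A; apply: SL2mx_inj; apply: mulVmx; exact: SL2_unit. Qed.
Fact SL2_Vmul : right_inverse SL2_one SL2_inv SL2_mul.
Proof. by move=> A; apply: SL2mx_inj; apply: mulmxV; exact: SL2_unit. Qed.

HB.instance Definition _ := isGroup.Build (SL2 R)
  SL2_mulA SL2_mul1 SL2_1mul SL2_mulV SL2_Vmul.

Definition eq_sign A B := (SL2mx A == SL2mx B) || (SL2mx A == - SL2mx B).

Fact eq_sign_refl : reflexive eq_sign.
Proof. by move=> A; rewrite /eq_sign eqxx. Qed.
Fact eq_sign_sym : symmetric eq_sign.
Proof.
by move=> A B; rewrite /eq_sign eq_sym; congr (_ || _); rewrite -eqr_oppLR eq_sym.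
Qed.
Fact eq_sign_trans : transitive eq_sign.
Proof.
move=> B A D /orP[] /eqP AB /orP[] /eqP BD; rewrite /eq_sign AB BD ?opprK eqxx//.
all: by rewrite ?orbT.
Qed.
Canonical eq_sign_equiv :=
  EquivRel eq_sign eq_sign_refl eq_sign_sym eq_sign_trans.

End SL2Group.

Definition PSL2 (R : realType) : Type :=
  quotient_topology {eq_quot (@eq_sign_equiv R)}.

HB.instance Definition _ (R : realType) := Choice.on (PSL2 R).
HB.instance Definition _ (R : realType) := Topological.on (PSL2 R).
HB.instance Definition _ (R : realType) := Quotient.on (PSL2 R).

Section PSL2Group.
Variable R : realType.
Implicit Types (A B : SL2 R) (g h : PSL2 R).

Definition toPSL2 A : PSL2 R := \pi_(PSL2 R) A.
Definition ofPSL2 g : SL2 R := repr g.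

Lemma ofPSL2K : cancel ofPSL2 toPSL2.
Proof. exact: reprK. Qed.

Lemma toPSL2P A B : reflect (toPSL2 A = toPSL2 B) (eq_sign A B).
Proof. exact: (@eqquotP _ (@eq_sign_equiv R) {eq_quot (@eq_sign_equiv R)}). Qed.

Lemma toPSL2K A : eq_sign (ofPSL2 (toPSL2 A)) A.
Proof. by apply/toPSL2P; rewrite ofPSL2K. Qed.

Definition PSL2_one : PSL2 R := toPSL2 (SL2_one R).
Definition PSL2_mul g h := toPSL2 (SL2_mul (ofPSL2 g) (ofPSL2 h)).
Definition PSL2_inv g := toPSL2 (SL2_inv (ofPSL2 g)).

Lemma toPSL2M A B : toPSL2 (SL2_mul A B) = PSL2_mul (toPSL2 A) (toPSL2 B).
Proof.
apply/toPSL2P; rewrite eq_sign_sym /eq_sign.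
have /orP[/eqP hA|/eqP hA] := toPSL2K A; have /orP[/eqP hB|/eqP hB] := toPSL2K B;
  by rewrite !SL2mxM hA hB ?mulmxN ?mulNmx ?opprK eqxx ?orbT.
Qed.

Lemma toPSL2V A : toPSL2 (SL2_inv A) = PSL2_inv (toPSL2 A).
Proof.
apply/toPSL2P; rewrite eq_sign_sym /eq_sign.
rewrite !SL2mxV; have /orP[/eqP->|/eqP->] := toPSL2K A; first by rewrite eqxx.
rewrite -scaleN1r invmxZ; last by rewrite unitmxE detZ SL2_det mulr1 sqrrN expr1n unitr1.
by rewrite (_ : (-1)^-1 = -1 :> R[i]) ?scaleN1r ?eqxx ?orbT// invrN invr1.
Qed.

Fact PSL2_mulA : associative PSL2_mul.
Proof.
move=> g h k; rewrite -(ofPSL2K g) -(ofPSL2K h) -(ofPSL2K k) -!toPSL2M.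
by rewrite SL2_mulA.
Qed.
Fact PSL2_mul1 : left_id PSL2_one PSL2_mul.
Proof. by move=> g; rewrite -(ofPSL2K g) -toPSL2M SL2_mul1. Qed.
Fact PSL2_1mul : right_id PSL2_one PSL2_mul.
Proof. by move=> g; rewrite -(ofPSL2K g) -toPSL2M SL2_1mul. Qed.
Fact PSL2_mulV : left_inverse PSL2_one PSL2_inv PSL2_mul.
Proof. by move=> g; rewrite -(ofPSL2K g) -toPSL2V -toPSL2M SL2_mulV. Qed.
Fact PSL2_Vmul : right_inverse PSL2_one PSL2_inv PSL2_mul.
Proof. by move=> g; rewrite -(ofPSL2K g) -toPSL2V -toPSL2M SL2_Vmul. Qed.

HB.instance Definition _ := isGroup.Build (PSL2 R)
  PSL2_mulA PSL2_mul1 PSL2_1mul PSL2_mulV PSL2_Vmul.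

End PSL2Group.

(* Projective ball model: H^3 is the open unit ball of R^3, compactified by the
   unit sphere; hyperbolic half-spaces are the traces of affine half-spaces.
   A point x is the ray of positive semidefinite Hermitian matrices spanned by
   [hermx 1 x], on which A in SL_2(C) acts by H |-> A H A^*.  The sphere
   consists of the rank one matrices v v^*; stereographic projection
   (z, 1) (z, 1)^* |-> z turns the action on it into z |-> (az+b)/(cz+d). *)
Section Model.
Variable R : realType.
Implicit Types (x y n : 'rV[R]_3) (c t : R) (A B H : 'M[R[i]]_2).
Local Open Scope sesquilinear_scope.

Definition dotv x y : R := \sum_i x 0 i * y 0 i.

Definition S2 : set 'rV[R]_3 := [set x | dotv x x = 1].
Definition H3 : set 'rV[R]_3 := [set x | dotv x x < 1].

Definition hermx t x : 'M[R[i]]_2 := \matrix_(i, j)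
  if i == 0 then
    if j == 0 then (t + x 0 2%:R)%:C else x 0 0 +i* x 0 1
  else
    if j == 0 then x 0 0 -i* x 0 1 else (t - x 0 2%:R)%:C.

Definition herm_time H : R := complex.Re (\tr H) / 2.
Definition herm_space H : 'rV[R]_3 := \row_i
  [:: complex.Re (H 0 1); complex.Im (H 0 1); complex.Re (H 0 0 - H 1 1) / 2]`_i.

Definition act_mx A x : 'rV[R]_3 :=
  let H := A *m hermx 1 x *m A^t* in (herm_time H)^-1 *: herm_space H.

(* For such n and c the plane dotv n x = c meets H^3 in a hyperbolic plane and
   S^2 in a non-degenerate circle. *)
Definition plane_params n c := dotv n n = 1 /\ -1 < c < 1.

Definition is_round_circle (C : set 'rV[R]_3) :=
  exists n c, plane_params n c /\ C = S2 `&` [set x | dotv n x = c].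

Definition is_open_round_disk (D : set 'rV[R]_3) :=
  exists n c, plane_params n c /\ D = S2 `&` [set x | c < dotv n x].

Lemma dotvE x y :
  dotv x y = x 0 0 * y 0 0 + x 0 1 * y 0 1 + x 0 2%:R * y 0 2%:R.
Proof.
rewrite /dotv !big_ord_recr big_ord0 /= add0r.
by congr (_ * _ + _ * _ + _ * _); congr (_ 0 _); apply: val_inj.
Qed.

Lemma mx2P A B : (A 0 0 = B 0 0) -> (A 0 1 = B 0 1) -> (A 1 0 = B 1 0) ->
  (A 1 1 = B 1 1) -> A = B.
Proof.
move=> h00 h01 h10 h11; apply/matrixP => i j.
by case: i j => [[|[|//]] hi] [[|[|//]] hj];
  rewrite ?(ord1 (Ordinal hi)) -?[Ordinal hi]/(_ : 'I_2);
  [move: h00|move: h01|move: h10|move: h11];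
  congr (A _ _ = B _ _); apply: val_inj.
Qed.

Lemma row3P x y : x 0 0 = y 0 0 -> x 0 1 = y 0 1 -> x 0 2%:R = y 0 2%:R -> x = y.
Proof.
move=> h0 h1 h2; apply/rowP => -[[|[|[|//]]] hi];
  [move: h0|move: h1|move: h2];
  by congr (x 0 _ = y 0 _); apply: val_inj.
Qed.

Lemma mx2M A B i j : (A *m B) i j = A i 0 * B 0 j + A i 1 * B 1 j.
Proof.
rewrite mxE !big_ord_recr big_ord0 /= add0r.
by congr (A _ _ * B _ _ + A _ _ * B _ _); apply: val_inj.
Qed.

Lemma mx2tr A : \tr A = A 0 0 + A 1 1.
Proof.
rewrite /mxtrace !big_ord_recr big_ord0 /= add0r.
by congr (A _ _ + A _ _); apply: val_inj.
Qed.

Lemma mx2det A : \det A = A 0 0 * A 1 1 - A 0 1 * A 1 0.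
Proof.
rewrite (expand_det_row A 0) !big_ord_recr big_ord0 /= add0r /cofactor /=.
rewrite !det_mx11 !mxE /= expr0 expr1 mul1r mulN1r mulrN.
by congr (A _ _ * A _ _ - A _ _ * A _ _); apply: val_inj.
Qed.

Lemma conjmxM A B : (A *m B)^t* = B^t* *m A^t*.
Proof. by rewrite trmx_mul map_mxM. Qed.

Lemma conjmxK A : A^t*^t* = A.
Proof. by apply/matrixP => i j; rewrite !mxE conjCK. Qed.

Lemma hermx_conj t x : (hermx t x)^t* = hermx t x.
Proof.
apply: mx2P; rewrite !mxE //=; apply/eqP; rewrite eq_complex /= ?opprK ?oppr0 ?eqxx //.
Qed.

Lemma hermxK H : H^t* = H -> hermx (herm_time H) (herm_space H) = H.
Proof.
move=> hH.
have h00 : conjc (H 0 0) = H 0 0 by rewrite -[in RHS]hH !mxE.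
have h11 : conjc (H 1 1) = H 1 1 by rewrite -[in RHS]hH !mxE.
have h10 : conjc (H 0 1) = H 1 0 by rewrite -[in RHS]hH !mxE.
rewrite /herm_time /herm_space mx2tr.
apply: mx2P; rewrite !mxE /= -?h10; move: h00 h11.
- case: (H 0 0) => a b; case: (H 1 1) => d e /= [b0] [e0].
  by apply/eqP; rewrite eq_complex /=; apply/andP; split; apply/eqP; lra.
- by case: (H 0 1).
- by case: (H 0 1).
- case: (H 0 0) => a b; case: (H 1 1) => d e /= [b0] [e0].
  by apply/eqP; rewrite eq_complex /=; apply/andP; split; apply/eqP; lra.
Qed.

Lemma hermxZ c t x : hermx (c * t) (c *: x) = c%:C *: hermx t x.
Proof.
by apply: mx2P; rewrite !mxE /=; apply/eqP; rewrite eq_complex /=;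
  apply/andP; split; apply/eqP; ring.
Qed.

Lemma herm_timeZ c H : herm_time (c%:C *: H) = c * herm_time H.
Proof.
rewrite /herm_time mxtraceZ; case: (\tr H) => a b /=; ring.
Qed.

Lemma herm_spaceZ c H : herm_space (c%:C *: H) = c *: herm_space H.
Proof.
apply: row3P; rewrite !mxE /=; case: (H 0 1) (H 0 0) (H 1 1) => [a b] [d e] [f g] /=;
  ring.
Qed.

Lemma herm_time_hermxM c t n x :
  herm_time (hermx c n *m hermx t x) = c * t + dotv n x.
Proof.
by rewrite /herm_time mx2tr !mx2M dotvE !mxE /=; field.
Qed.

Lemma det_hermx t x : \det (hermx t x) = (t ^+ 2 - dotv x x)%:C.
Proof.
rewrite mx2det dotvE !mxE /=.
by apply/eqP; rewrite eq_complex /=; apply/andP; split; apply/eqP; ring.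
Qed.

Lemma time_cone (p0 p1 p2 p3 x1 x2 x3 : R) : 0 <= p0 ->
  p0 ^+ 2 = 1 + p1 ^+ 2 + p2 ^+ 2 + p3 ^+ 2 ->
  x1 * x1 + x2 * x2 + x3 * x3 <= 1 -> 0 < p0 + (p1 * x1 + p2 * x2 + p3 * x3).
Proof.
move=> p_ge0 p_eq x_le1; rewrite ltNge; apply/negP => le0.
set q := p1 * x1 + p2 * x2 + p3 * x3 in le0.
have q2 : p0 ^+ 2 <= q ^+ 2.
  by rewrite -(sqrrN q); apply: lerXn2r; rewrite ?nnegrE; lra.
have CS : q ^+ 2 <= (p1 ^+ 2 + p2 ^+ 2 + p3 ^+ 2) * (x1 * x1 + x2 * x2 + x3 * x3).
  rewrite -subr_ge0 [leRHS](_ : _ = (p1 * x2 - p2 * x1) ^+ 2 +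
    (p1 * x3 - p3 * x1) ^+ 2 + (p2 * x3 - p3 * x2) ^+ 2); last by rewrite /q; ring.
  by rewrite !addr_ge0// sqr_ge0.
have : (p1 ^+ 2 + p2 ^+ 2 + p3 ^+ 2) * (x1 * x1 + x2 * x2 + x3 * x3) <=
       p1 ^+ 2 + p2 ^+ 2 + p3 ^+ 2.
  by rewrite ler_piMr// !addr_ge0// sqr_ge0.
lra.
Qed.

Lemma herm_time_gt0 A x : \det A = 1 -> dotv x x <= 1 ->
  0 < herm_time (A *m hermx 1 x *m A^t*).
Proof.
rewrite mx2det dotvE => hA hx.
rewrite /herm_time mx2tr !mx2M !mxE /=.
move: hA; case: (A 0 0) (A 0 1) (A 1 0) (A 1 1) => [a1 a2] [b1 b2] [c1 c2] [d1 d2].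
move=> /= [h1 h2].
move: hx; set X := x 0 0; set Y := x 0 1; set Z := x 0 2%:R => hx.
set U := a1 ^+ 2 + a2 ^+ 2 + c1 ^+ 2 + c2 ^+ 2.
set V := b1 ^+ 2 + b2 ^+ 2 + d1 ^+ 2 + d2 ^+ 2.
have := @time_cone ((U + V) / 2) (a1 * b1 + a2 * b2 + c1 * d1 + c2 * d2)
  (a1 * b2 - a2 * b1 + c1 * d2 - c2 * d1) ((U - V) / 2) X Y Z.
have -> : 0 <= (U + V) / 2.
  by rewrite divr_ge0// /U /V !addr_ge0// sqr_ge0.
move=> /(_ isT) H.
rewrite [ltRHS](_ : _ = (U + V) / 2 + ((a1 * b1 + a2 * b2 + c1 * d1 + c2 * d2) * X +
  (a1 * b2 - a2 * b1 + c1 * d2 - c2 * d1) * Y + (U - V) / 2 * Z));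
  last by rewrite /U /V; field.
apply: H => //.
rewrite [X in _ = X + _ + _ + _](_ : _ =
  (a1 * d1 - a2 * d2 - (b1 * c1 - b2 * c2)) ^+ 2 +
  (a1 * d2 + a2 * d1 - (b1 * c2 + b2 * c1)) ^+ 2); last by rewrite h1 h2; ring.
by rewrite /U /V; field.
Qed.

Lemma conj_herm A H : H^t* = H -> (A *m H *m A^t*)^t* = A *m H *m A^t*.
Proof. by move=> hH; rewrite !conjmxM conjmxK hH mulmxA. Qed.

Lemma act_mxK A x : \det A = 1 -> dotv x x <= 1 ->
  A *m hermx 1 x *m A^t* =
  (herm_time (A *m hermx 1 x *m A^t*))%:C *: hermx 1 (act_mx A x).
Proof.
move=> hA hx; have t_gt0 := herm_time_gt0 hA hx.
rewrite -hermxZ mulr1 /act_mx /= scalerA divff ?gt_eqF// scale1r hermxK//.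
by rewrite conj_herm ?hermx_conj.
Qed.

Lemma herm_time_hermx t x : herm_time (hermx t x) = t.
Proof. by rewrite /herm_time mx2tr !mxE /=; field. Qed.

Lemma herm_space_hermx t x : herm_space (hermx t x) = x.
Proof. by apply: row3P; rewrite !mxE //=; field. Qed.

Lemma act_mx1 x : act_mx 1%:M x = x.
Proof.
rewrite /act_mx /= mul1mx (_ : 1%:M^t* = 1%:M) ?mulmx1.
  by rewrite herm_time_hermx herm_space_hermx invr1 scale1r.
by rewrite trmx1 map_mx1.
Qed.

Lemma act_mxM A B x : \det B = 1 -> dotv x x <= 1 ->
  act_mx (A *m B) x = act_mx A (act_mx B x).
Proof.
move=> hB hx; have t_gt0 := herm_time_gt0 hB hx.
have E : A *m B *m hermx 1 x *m (A *m B)^t* = A *m (B *m hermx 1 x *m B^t*) *m A^t*.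
  by rewrite conjmxM !mulmxA.
rewrite [LHS]/act_mx /= E (act_mxK hB hx).
rewrite -scalemxAr -scalemxAl herm_timeZ herm_spaceZ scalerA.
by rewrite invfM mulrAC mulVf ?gt_eqF// mul1r.
Qed.

Lemma act_mxN A x : act_mx (- A) x = act_mx A x.
Proof.
rewrite /act_mx /= (_ : (- A)^t* = - A^t*) ?mulNmx ?mulmxN ?opprK//.
by apply/matrixP => i j; rewrite !mxE rmorphN.
Qed.

Lemma det_conj A : \det A = 1 -> \det (A^t*) = 1.
Proof. by move=> hA; rewrite det_map_mx det_tr hA rmorph1. Qed.

Lemma act_mx_norm A x : \det A = 1 -> dotv x x <= 1 ->
  herm_time (A *m hermx 1 x *m A^t*) ^+ 2 *
  (1 - dotv (act_mx A x) (act_mx A x)) = 1 - dotv x x.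
Proof.
move=> hA hx; have /(congr1 determinant) := act_mxK hA hx.
rewrite detZ !det_mulmx hA det_conj// mul1r mulr1 !det_hermx expr1n.
by set t := herm_time _; rewrite -rmorphXn -rmorphM /= => -[].
Qed.

Lemma act_mx_S2 A x : \det A = 1 -> S2 x -> S2 (act_mx A x).
Proof.
rewrite /S2 /= => hA hx; have hx1 : dotv x x <= 1 by rewrite hx.
have /eqP := act_mx_norm hA hx1; rewrite hx subrr mulf_eq0 expf_eq0 /=.
by rewrite gt_eqF ?herm_time_gt0//= subr_eq0 => /eqP.
Qed.

Lemma act_mx_H3 A x : \det A = 1 -> H3 x -> H3 (act_mx A x).
Proof.
rewrite /H3 /= => hA hx; have := act_mx_norm hA (ltW hx).
move=> /(congr1 (fun r => 0 < r)); rewrite subr_gt0 hx.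
by rewrite pmulr_rgt0 ?exprn_gt0 ?herm_time_gt0 ?ltW// subr_gt0.
Qed.

Lemma act_mx_VK A x : \det A = 1 -> dotv x x <= 1 ->
  act_mx A (act_mx (invmx A) x) = x.
Proof.
move=> hA hx; have uA : A \in unitmx by rewrite unitmxE hA unitr1.
by rewrite -act_mxM ?mulmxV ?act_mx1// det_inv hA invr1.
Qed.

Lemma act_mx_round_circle A (C : set 'rV[R]_3) : \det A = 1 ->
  is_round_circle C -> is_round_circle (act_mx A @` C).
Proof.
move=> hA [n [c [[n1 /andP[cgt clt]] ->]]].
have uA : A \in unitmx by rewrite unitmxE hA unitr1.
have hV : \det (invmx A) = 1 by rewrite det_inv hA invr1.
pose N := (invmx A)^t* *m hermx (- c) n *m invmx A.
have hN : N^t* = N by rewrite /N !conjmxM conjmxK hermx_conj mulmxA.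
set c1 := - herm_time N; set n1' := herm_space N.
have NE : N = hermx (- c1) n1' by rewrite /c1 opprK hermxK.
have detN : c1 ^+ 2 - dotv n1' n1' = c ^+ 2 - 1.
  have := congr1 determinant NE; rewrite !det_mulmx hV det_conj// mul1r mulr1.
  by rewrite !det_hermx n1 !sqrrN => -[].
have side x : S2 x -> exists2 t, t != 0 &
    dotv n x - c = t * (dotv n1' (act_mx A x) - c1).
  move=> Sx; have hx : dotv x x <= 1 by rewrite Sx.
  exists (herm_time (A *m hermx 1 x *m A^t*)); first by rewrite gt_eqF ?herm_time_gt0.
  have -> : dotv n x - c = herm_time (N *m (A *m hermx 1 x *m A^t*)).
    have AV : A^t* *m (invmx A)^t* = 1%:M.
      by rewrite -conjmxM mulVmx// trmx1 map_mx1.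
    have -> : N *m (A *m hermx 1 x *m A^t*) =
        (invmx A)^t* *m (hermx (- c) n *m hermx 1 x *m A^t*).
      rewrite /N !mulmxA; congr (_ *m _ *m _).
      by rewrite -(mulmxA _ (invmx A) A) (mulVmx uA) mulmx1.
    rewrite /herm_time mxtrace_mulC -(mulmxA _ (A^t*) ((invmx A)^t*)) AV mulmx1.
    have := herm_time_hermxM (- c) 1 n x; rewrite /herm_time mulr1 => ->.
    by rewrite addrC.
  have := act_mxK hA hx; set t := herm_time (A *m _ *m _) => ->.
  rewrite -scalemxAr herm_timeZ {1}NE herm_time_hermxM mulr1.
  by rewrite [- c1 + _]addrC.
have c2_lt1 : c ^+ 2 < 1.
  have : 0 < (1 - c) * (1 + c) by apply: mulr_gt0; lra.
  by rewrite mulrDr mulr1 mulrBl mul1r -expr2; lra.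
have q_gt0 : 0 < dotv n1' n1' by have := sqr_ge0 c1; lra.
set q := Num.sqrt (dotv n1' n1').
have q0 : 0 < q by rewrite sqrtr_gt0.
have q2 : q ^+ 2 = dotv n1' n1' by rewrite sqr_sqrtr// ltW.
have dotZ y : dotv (q^-1 *: n1') y = q^-1 * dotv n1' y.
  by rewrite !dotvE !mxE; ring.
exists (q^-1 *: n1'), (q^-1 * c1); split.
  split.
    rewrite dotZ (_ : dotv n1' _ = q^-1 * dotv n1' n1'); last by rewrite !dotvE !mxE; ring.
    by rewrite -q2; field; rewrite gt_eqF.
  have c1q : c1 ^+ 2 < q ^+ 2 by rewrite q2; lra.
  rewrite -ltr_norml normrM normfV (gtr0_norm q0) mulrC ltr_pdivrMr// mul1r.
  by rewrite -(gtr0_norm q0) -ltr_sqr ?nnegrE// !real_normK ?num_real.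
rewrite eqEsubset; split => [_ [x [Sx /= nx] <-]|y [Sy /= ny]].
  split; first exact: act_mx_S2.
  have [t t0] := side _ Sx; rewrite nx subrr => /esym/eqP.
  by rewrite mulf_eq0 (negbTE t0)/= subr_eq0 => /eqP e; rewrite /= dotZ e.
have Sx := act_mx_S2 hV Sy.
have yK : act_mx A (act_mx (invmx A) y) = y by rewrite act_mx_VK// Sy.
exists (act_mx (invmx A) y) => //; split => //=.
have [t t0] := side _ Sx; rewrite yK.
have -> : dotv n1' y = c1.
  by apply: (mulfI (x := q^-1)); rewrite ?invr_eq0 ?gt_eqF// -dotZ.
by rewrite subrr mulr0 => /eqP; rewrite subr_eq0 => /eqP.
Qed.

End Model.

Arguments S2 R : clear implicits.
Arguments H3 R : clear implicits.

Section Action.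
Variable R : realType.
Implicit Types (g h : PSL2 R) (x : 'rV[R]_3).

Definition act g x : 'rV[R]_3 := act_mx (SL2mx (ofPSL2 g)) x.

Lemma act_toPSL2 (A : SL2 R) x : act (toPSL2 A) x = act_mx (SL2mx A) x.
Proof.
by rewrite /act; have /orP[/eqP->|/eqP->] := toPSL2K A; rewrite ?act_mxN.
Qed.

Lemma act1 x : act 1%g x = x.
Proof. by rewrite [1%g]/(toPSL2 _) act_toPSL2 act_mx1. Qed.

Lemma actM g h x : dotv x x <= 1 -> act (g * h)%g x = act g (act h x).
Proof.
move=> hx; rewrite [(g * h)%g]/(toPSL2 _) act_toPSL2 SL2mxM.
by rewrite (act_mxM _ (SL2_det _) hx).
Qed.

Lemma act_S2 g x : S2 R x -> S2 R (act g x).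
Proof. exact/act_mx_S2/SL2_det. Qed.

Lemma act_H3 g x : H3 R x -> H3 R (act g x).
Proof. exact/act_mx_H3/SL2_det. Qed.

End Action.

Record circle (R : realType) := Circle {
  circle_set :> set 'rV[R]_3;
  circleP : is_round_circle circle_set }.

Section Circles.
Variable R : realType.

HB.instance Definition _ := gen_eqMixin (circle R).
HB.instance Definition _ := gen_choiceMixin (circle R).

Definition circle_act (g : PSL2 R) (C : circle R) : circle R :=
  Circle (act_mx_round_circle (SL2_det (ofPSL2 g)) (circleP C)).

Fact extended_real_line_round :
  is_round_circle (S2 R `&` [set x : 'rV[R]_3 | dotv (delta_mx 0 1) x = 0]).
Proof.
exists (delta_mx 0 1), 0; split => //; split; last by rewrite ltrN10 ltr01.
by rewrite dotvE !mxE /=; ring.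
Qed.

Definition extended_real_line : circle R := Circle extended_real_line_round.

(* PGL_2(R) is the stabilizer of the extended real line in PSL_2(C), so this is
   the quotient topology of PSL_2(C) / PGL_2(R) carried over to circles by
   g PGL_2(R) |-> g (extended real line). *)
Definition circle_open (U : set (circle R)) : Prop :=
  open [set g : PSL2 R | U (circle_act g extended_real_line)].

Fact circle_openT : circle_open setT.
Proof. exact: openT. Qed.
Fact circle_openI U V : circle_open U -> circle_open V -> circle_open (U `&` V).
Proof. exact: openI. Qed.
Fact circle_open_bigU (I : Type) (f : I -> set (circle R)) :
  (forall i, circle_open (f i)) -> circle_open (\bigcup_i f i).
Proof. by move=> fo; apply: (@bigcup_open _ I setT) => i _; exact: fo. Qed.

HB.instance Definition _ := isOpenTopological.Build (circle R)
  circle_openT circle_openI circle_open_bigU.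

End Circles.

Section Kleinian.
Variable R : realType.
Implicit Types (Gamma : set (PSL2 R)) (P L : set 'rV[R]_3).

Definition subgroup Gamma := [/\ Gamma 1%g,
  forall g h, Gamma g -> Gamma h -> Gamma (g * h)%g &
  forall g, Gamma g -> Gamma (g^-1)%g].

Definition kleinian Gamma := subgroup Gamma /\ Gamma `<=` isolated Gamma.

Definition torsion_free Gamma :=
  forall g k, Gamma g -> (0 < k)%N -> (g ^+ k = 1)%g -> g = 1%g.

Definition fundamental_domain Gamma P := [/\ P `<=` H3 R,
  \bigcup_(g in Gamma) (act g @` P) = H3 R,
  forall g, Gamma g -> g <> 1%g -> (act g @` interior P) `&` interior P = set0 &
  forall x, H3 R x -> exists2 U, nbhs x U &
    finite_set [set g | Gamma g /\ (act g @` P) `&` U !=set0]].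

(* The fundamental domain is an exact convex polyhedron: it is cut out by
   finitely many hyperbolic half-spaces, and each of its sides is its
   intersection with a Gamma-translate of it. *)
Definition geometrically_finite Gamma :=
  exists (m : nat) (n : 'I_m -> 'rV[R]_3) (c : 'I_m -> R),
    let P := [set x | H3 R x /\ forall i, c i <= dotv (n i) x] in
    [/\ forall i, plane_params (n i) (c i),
        fundamental_domain Gamma P &
        forall i, exists2 g, Gamma g &
          P `&` [set x | dotv (n i) x = c i] = P `&` (act g @` P)].

Definition limit_set Gamma (o : 'rV[R]_3) : set 'rV[R]_3 :=
  closure [set act g o | g in Gamma] `&` S2 R.

Definition circle_packing L := exists D : nat -> set 'rV[R]_3,
  [/\ injective D,
      forall i, is_open_round_disk (D i),
      L = S2 R `\` \bigcup_i D i &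
      range D = [set connected_component (S2 R `\` L) x
                | x in S2 R `\` L]].

Definition circles_meeting L (k : nat) : set (circle R) :=
  [set C : circle R | (C `&` L #= `I_k)%card].

Definition accumulation_point (B : set (circle R)) (C : circle R) :=
  exists u : nat -> circle R,
    (forall i, B (u i) /\ u i <> C) /\ u @ \oo --> C.

End Kleinian.

(* Main.v *)
Require Import Defs.
From mathcomp Require Import all_boot all_order all_algebra.
From mathcomp Require Import ring lra complex finmap.
From mathcomp Require Import all_classical all_reals all_analysis.
Set Implicit Arguments.
Unset Strict Implicit.
Unset Printing Implicit Defensive.
Import Order.TTheory GRing.Theory Num.Theory.
Import numFieldNormedType.Exports.
Local Open Scope classical_set_scope.
Local Open Scope ring_scope.

(** Let [C] be a circle meeting the limit set [L] in [m >= 2] points.  These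
    points cut [C] into [m] open arcs.  An arc is connected and misses [L], so it
    lies in one of the disks; a disk meets [C] in a connected set that misses
    [L], so distinct arcs lie in distinct disks.  Hence [C] hits exactly [m]
    disks ([card_hit_disks]), and each point of [C] in [L] is a common boundary
    point of two of them ([residual_two_disks]).  Two disjoint disks share at most
    one boundary point, as there is a third disk disjoint from both
    ([tangency_point_unique]): the disks hit by [C] have finitely many tangency
    points in all.

    Suppose now that [m >= k >= 3].  A circle [C'] close to [C] still hits the
    disks hit by [C], and still misses the finitely many tangency points of these
    disks that are not on [C].  If [C'] meets [L] in [k] points, it hits only [k]
    disks, hence exactly those hit by [C].  So its points in [L] are tangency
    points of these disks, which must lie on [C]; there are at least three of
    them, and three points determine a circle, so [C' = C].  This is
    [circle_isolated_among_fewer].  For [m = k] it says that the circles meeting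
    [L] in [k] points are isolated from each other, and for any [m >= k] that they
    do not accumulate at [C].

    The cutting of a circle into arcs takes place on the real line: stereographic
    projection from a point of [C] in [L] ([chart_exists]) turns the disks into the
    solution sets of concave quadratic inequalities, that is, into intervals.  The
    projection point is outside the disks, which is what makes the leading
    coefficients nonpositive.

    Invariance holds because the group acts by homeomorphisms that permute the
    orbit, and so preserve the limit set. *)

(** * Finitely many points cutting the real line *)

Section LineCuts.
Variable R : realType.

Lemma sorted_gap_points (s : seq R) (b : R) (j : nat) :
  path <%R b s -> (j <= size s)%N ->
  exists a, [/\ b < a, a \notin s & count [pred x : R | (x < a)%R] s = j].
Proof.
elim: s b j => [|t s IHs] b j /=.
  by move=> _; rewrite leqn0 => /eqP ->; exists (b + 1); rewrite ltrDl ltr01.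
move=> /andP[bt ts]; case: j => [|j] /=.
  move=> _; have ats : all (> t) s by apply: order_path_min ts; exact: lt_trans.
  have [ba at_] := (midf_lt bt).
  exists ((b + t) / 2); split => //.
    rewrite inE negb_or lt_eqF//=; apply/negP => /(allP ats).
    by rewrite ltNge ltW.
  rewrite ltNge ltW//= -[RHS](@count_pred0 _ s).
  apply: eq_in_count => x /(allP ats) tx /=; apply/negbTE.
  by rewrite -leNgt ltW// (lt_trans at_).
rewrite ltnS => js; have [a [ta aNs aj]] := IHs t j ts js.
exists a; split; first exact: lt_trans ta.
  by rewrite inE negb_or gt_eqF.
by rewrite ta aj.
Qed.

Variables (T : set R) (J : nat -> set R).
Hypotheses (T_fin : finite_set T) (J_open : forall i, open (J i))
  (J_itv : forall i, is_interval (J i)) (J_disj : trivIset setT J)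
  (J_cover : ~` T = \bigcup_i J i).

Lemma cut_covered t : ~ T t -> exists i, J i t.
Proof. by rewrite -[~ T t]/((~` T) t) J_cover => -[i _]; exists i. Qed.

Lemma cut_notin i t : J i t -> ~ T t.
Proof. by move=> Jt; rewrite -[~ T t]/((~` T) t) J_cover; exists i. Qed.

Lemma cut_eq_index i j t : J i t -> J j t -> i = j.
Proof. by move=> Ji Jj; apply: J_disj => //; exists t. Qed.

(** The segment is connected and the pieces meeting it are open and disjoint. *)
Lemma cut_segment a b i x y : `[a, b]%classic `<=` ~` T ->
  x \in `[a, b] -> y \in `[a, b] -> J i x -> J i y.
Proof.
move=> abT xab yab Jix.
have BE : `[a, b]%classic `&` J i = `[a, b]%classic.
  apply: (@segment_connected R a b).
  - by exists x.
  - by exists (J i).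
  - exists (~` \bigcup_(j in [set j | j <> i]) J j).
      by apply: open_closedC; apply: bigcup_open => j _; exact: J_open.
    apply/seteqP; split => z [abz Jz]; split => //.
      by move=> [j /= ji Jjz]; apply: ji; exact: cut_eq_index Jjz Jz.
    have [j Jjz] := cut_covered (abT _ abz).
    by have [<-//|ji] := pselect (j = i); case: Jz; exists j.
by have : `[a, b]%classic y by []; rewrite -BE => -[].
Qed.

(** The two pieces adjacent to a cut point are distinct because a piece is an
    interval that avoids the cut points. *)
Lemma cut_two_sides t : T t -> exists i j,
  [/\ i <> j, closure (J i) t & closure (J j) t].
Proof.
move=> Tt.
have : nbhs t (~` (T `\ t)).
  apply: open_nbhs_nbhs; split; last by move=> [_]; apply.
  apply: closed_openC; apply: (accessible_finite_set_closed (T := R)).1.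
    exact/hausdorff_accessible/order_hausdorff.
  exact: finite_setD.
move=> /nbhs_ballP[e /= e0 eT].
have freeT x : x != t -> `|t - x| < e -> ~ T x.
  by move=> xt tx Tx; apply: (eT x tx); split => //=; apply/eqP.
have [|i Ji] := @cut_covered (t - e / 2).
  by apply: freeT; [rewrite lt_eqF//; lra | rewrite opprB addrC subrK gtr0_norm; lra].
have [|j Jj] := @cut_covered (t + e / 2).
  apply: freeT; [rewrite gt_eqF//; lra|].
  by rewrite opprD addrA subrr sub0r normrN gtr0_norm; lra.
have close V : nbhs t V -> exists m, [/\ 0 < m, m <= e / 2, V (t - m) & V (t + m)].
  move=> /nbhs_ballP[d /= d0 dV].
  have dm0 : 0 < Num.min d e by rewrite lt_min d0.
  have dmd : Num.min d e <= d by rewrite ge_min lexx.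
  have dme : Num.min d e <= e by rewrite ge_min lexx orbT.
  exists (Num.min d e / 2); split; [lra|lra| |]; apply: dV; rewrite /ball /=.
    by rewrite opprB addrC subrK gtr0_norm; lra.
  by rewrite opprD addrA subrr sub0r normrN gtr0_norm; lra.
exists i, j; split.
- move=> ij; rewrite -ij in Jj; apply: (@cut_notin i t) => //.
  by apply: (J_itv Ji Jj); apply/andP; split; lra.
- move=> V /close[m [m0 me Vm _]]; exists (t - m); split => //.
  apply: (@cut_segment (t - e / 2) (t - m)) Ji => //.
  + move=> x /=; rewrite in_itv /= => /andP[x1 x2].
    by apply: freeT; [rewrite lt_eqF//; lra | rewrite gtr0_norm; lra].
  + by rewrite in_itv /=; apply/andP; split; lra.
  + by rewrite in_itv /=; apply/andP; split; lra.
- move=> V /close[m [m0 me _ Vm]]; exists (t + m); split => //.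
  apply: (@cut_segment (t + m) (t + e / 2)) Jj => //.
  + move=> x /=; rewrite in_itv /= => /andP[x1 x2].
    by apply: freeT; [rewrite gt_eqF//; lra | rewrite ltr0_norm; lra].
  + by rewrite in_itv /=; apply/andP; split; lra.
  + by rewrite in_itv /=; apply/andP; split; lra.
Qed.

(** A piece is recognized by the number of cut points to its left, and every
    number from 0 to [#|T|] occurs. *)
Lemma cut_card m : (T #= `I_m)%card -> ([set i | J i !=set0] #= `I_m.+1)%card.
Proof.
move=> Tm.
have [s [s_lt Ts s_size]] : exists s, [/\ sorted <%R s, T = [set` s] & size s = m].
  have /finite_fsetP[X TX] := T_fin.
  exists (sort <=%R X); split; first by rewrite sort_lt_sorted fset_uniq.
    by rewrite TX; apply/seteqP; split => x /=; rewrite mem_sort.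
  by rewrite size_sort; apply/card_eq_fsetP; rewrite -TX.
(* The number of cut points to the left of [a]. *)
pose N a := count [pred x : R | (x < a)%R] s.
have N_le a b : a <= b -> N a = N b -> forall t, T t -> a <= t -> b <= t.
  move=> ab NN t Tt at_; rewrite leNgt; apply/negP => tb.
  have : (0 < count [pred x : R | (a <= x < b)%R] s)%N.
    by rewrite -has_count; apply/hasP; exists t; [rewrite Ts in Tt|rewrite /= at_].
  have := count_predUI [pred x : R | (a <= x < b)%R] [pred x : R | (x < a)%R] s.
  have -> : count (predI [pred x : R | (a <= x < b)%R] [pred x : R | (x < a)%R]) s = 0%N.
    rewrite -[RHS](@count_pred0 _ s); apply: eq_count => x /=.
    by case: (leP a x); rewrite ?andbF.
  rewrite addn0 -/(N a) (_ : count (predU _ _) s = N b).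
    by rewrite NN => /eqP; rewrite -[X in X == _]add0n eqn_add2r => /eqP <-.
  apply: eq_count => x /=; case: (ltP x a) => //= xa; rewrite ?orbF//.
  by rewrite (lt_le_trans xa ab).
have N_eq a b i j : J i a -> J j b -> N a = N b -> i = j.
  wlog ab : a b i j / a <= b => [H|] Ji Jj NN.
    by have [/H|/ltW /H] := leP a b; [apply | move=> H'; apply/esym/H'].
  apply: (@cut_eq_index i j b) => //; apply: (@cut_segment a b i a) => //.
  - move=> t /=; rewrite in_itv /= => /andP[at_ tb] Tt.
    have bt := N_le _ _ ab NN _ Tt at_.
    by apply: (cut_notin Jj); rewrite (@le_anti _ _ b t) ?bt.
  - by rewrite in_itv /= lexx.
  - by rewrite in_itv /= lexx andbT.
have N_mono i a b : J i a -> J i b -> N a = N b.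
  move=> Ja Jb; apply: eq_in_count => t ts.
  have Tt : T t by rewrite Ts.
  apply/idP/idP => /= [ta|tb]; rewrite ltNge; apply/negP => h;
    apply: (@cut_notin i t _ Tt).
  - by apply: (J_itv Jb Ja); rewrite h ltW.
  - by apply: (J_itv Ja Jb); rewrite h ltW.
pose y i := xget 0 (J i).
have yP i : J i !=set0 -> J i (y i) by case=> z; exact: xgetI.
apply/card_set_bijP; exists (fun i => N (y i)); split.
- by move=> i _ /=; rewrite ltnS -s_size count_size.
- move=> i j /set_mem /= /yP Ji /set_mem /= /yP Jj; exact: N_eq.
- move=> j /= jm.
  have [b bs] : exists b, path <%R b s.
    case: (s) s_lt => [|t s'] /= h; first by exists 0.
    by exists (t - 1); rewrite h andbT; lra.
  have [|a [_ aNs aj]] := @sorted_gap_points s b j bs; first by rewrite s_size -ltnS.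
  have [|i Jia] := @cut_covered a; first by rewrite Ts /=; exact/negP.
  have Ji0 : J i !=set0 by exists a.
  by exists i => //; rewrite (N_mono i _ a)//; exact: yP.
Qed.

End LineCuts.

(** * Circles and disks of the sphere *)

Section SphereGeometry.
Variable R : realType.
Implicit Types (x y z n m p u v e f : 'rV[R]_3) (a b c d t s r : R).

Lemma dotvC x y : dotv x y = dotv y x.
Proof. by rewrite !dotvE; ring. Qed.

Lemma dotvDr x y z : dotv x (y + z) = dotv x y + dotv x z.
Proof. by rewrite !dotvE !mxE; ring. Qed.

Lemma dotvZr a x y : dotv x (a *: y) = a * dotv x y.
Proof. by rewrite !dotvE !mxE; ring. Qed.

Lemma dotvDl x y z : dotv (x + y) z = dotv x z + dotv y z.
Proof. by rewrite !dotvE !mxE; ring. Qed.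

Lemma dotvZl a x y : dotv (a *: x) y = a * dotv x y.
Proof. by rewrite !dotvE !mxE; ring. Qed.

Lemma dotvNl x y : dotv (- x) y = - dotv x y.
Proof. by rewrite !dotvE !mxE; ring. Qed.

Lemma dotv_ge0 x : 0 <= dotv x x.
Proof. by rewrite dotvE !addr_ge0// -expr2 sqr_ge0. Qed.

Lemma dotv_eq0 x : dotv x x = 0 -> x = 0.
Proof.
rewrite dotvE -!expr2 => h.
have := sqr_ge0 (x 0 0); have := sqr_ge0 (x 0 1); have := sqr_ge0 (x 0 2%:R).
move=> h2 h1 h0.
by apply: row3P; rewrite mxE; apply/eqP; rewrite -sqrf_eq0; apply/eqP; lra.
Qed.

Lemma orthonormal_expansion n e f y :
  dotv n n = 1 -> dotv e e = 1 -> dotv f f = 1 ->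
  dotv n e = 0 -> dotv n f = 0 -> dotv e f = 0 ->
  y = dotv n y *: n + dotv e y *: e + dotv f y *: f.
Proof.
move=> nn ee ff ne nf ef.
pose M : 'M[R]_3 := \matrix_(i, j) [:: n; e; f]`_i 0 j.
have MM : M *m M^T = 1%:M.
  apply/matrixP => i j; rewrite !mxE.
  transitivity (dotv [:: n; e; f]`_i [:: n; e; f]`_j).
    by apply: eq_bigr => k _; rewrite !mxE.
  case: i j => [[|[|[|//]]] hi] [[|[|[|//]]] hj] /=;
    rewrite ?nn ?ee ?ff ?ne ?nf ?ef // dotvC ?ne ?nf ?ef //.
have yMM : y = (y *m M^T) *m M by rewrite -mulmxA (mulmx1C MM) mulmx1.
have yM i : (y *m M^T) 0 i = dotv [:: n; e; f]`_i y.
  by rewrite mxE dotvC; apply: eq_bigr => k _; rewrite !mxE.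
apply/rowP => j; rewrite [LHS](congr1 (fun w : 'rV_3 => w 0 j) yMM) mxE.
by rewrite !big_ord_recr big_ord0 /= add0r !yM !mxE /=.
Qed.

(** Stereographic projection of a circle from its point [p], which becomes the
    point at infinity of the line: for suitable [u] and [v] this is a bijection
    from the line onto the circle minus [p]. *)
Definition chart p u v t := p + (1 + t ^+ 2)^-1 *: (u + t *: v).

Lemma chart_den_gt0 t : 0 < 1 + t ^+ 2.
Proof. by have := sqr_ge0 t; lra. Qed.

Lemma chart_exists n c p : plane_params n c -> S2 R p -> dotv n p = c ->
  exists u v, injective (chart p u v) /\
    forall y, (S2 R y /\ dotv n y = c) /\ y <> p <-> exists t, y = chart p u v t.
Proof.
move=> [nn /andP[c_gt c_lt]] Sp np.
have c2 : 0 < 1 - c ^+ 2.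
  by have -> : 1 - c ^+ 2 = (1 - c) * (1 + c); [ring | apply: mulr_gt0; lra].
pose r := Num.sqrt (1 - c ^+ 2).
have r0 : 0 < r by rewrite sqrtr_gt0.
have rn0 : r != 0 by rewrite gt_eqF.
have r2 : r ^+ 2 = 1 - c ^+ 2 by rewrite sqr_sqrtr// ltW.
(* [n], [e], [f] is an orthonormal frame in which [p = c n + r e]; the circle
   is described by an angle in the plane of [e] and [f], and the parameter of
   the chart is the cotangent of half this angle. *)
pose e := r^-1 *: (p - c *: n).
have pE : p = c *: n + r *: e by rewrite scalerA divff// scale1r addrC subrK.
have pp : dotv p p = 1 by [].
have ee : dotv e e = 1.
  have : dotv (p - c *: n) (p - c *: n) = r ^+ 2.
    rewrite -scaleNr !(dotvDl, dotvDr, dotvZl, dotvZr) (dotvC p n) np nn pp r2.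
    by ring.
  by rewrite /e !(dotvZl, dotvZr) => ->; field.
have ne : dotv n e = 0.
  by rewrite /e dotvZr -scaleNr dotvDr dotvZr nn np; ring.
clearbody e.
pose f : 'rV[R]_3 := \row_i
  [:: n 0 1 * e 0 2%:R - n 0 2%:R * e 0 1; n 0 2%:R * e 0 0 - n 0 0 * e 0 2%:R;
      n 0 0 * e 0 1 - n 0 1 * e 0 0]`_i.
have nf : dotv n f = 0 by rewrite dotvE !mxE /=; ring.
have ef : dotv e f = 0 by rewrite dotvE !mxE /=; ring.
have ff : dotv f f = 1.
  have -> : dotv f f = dotv n n * dotv e e - dotv n e ^+ 2.
    by rewrite !dotvE !mxE /=; ring.
  by rewrite nn ee ne; ring.
clearbody f.
have expand y := orthonormal_expansion y nn ee ff ne nf ef.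
exists (- (2 * r) *: e), (2 * r *: f).
have dots t : [/\ dotv n (chart p (- (2 * r) *: e) (2 * r *: f) t) = c,
    dotv e (chart p (- (2 * r) *: e) (2 * r *: f) t) = r - 2 * r / (1 + t ^+ 2) &
    dotv f (chart p (- (2 * r) *: e) (2 * r *: f) t) = 2 * r * t / (1 + t ^+ 2)].
  have t0 : 1 + t ^+ 2 != 0 by rewrite gt_eqF ?chart_den_gt0.
  have en : dotv e n = 0 by rewrite dotvC.
  have fn : dotv f n = 0 by rewrite dotvC.
  have fe : dotv f e = 0 by rewrite dotvC.
  rewrite /chart pE !(dotvDr, dotvZr) nn ee ff ne nf ef en fn fe.
  by split; field.
split.
  move=> t s ts.
  have [_ e1 f1] := dots t; have [_ e2 f2] := dots s.
  have t0 := chart_den_gt0 t; have s0 := chart_den_gt0 s.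
  have : (1 + t ^+ 2)^-1 = (1 + s ^+ 2)^-1.
    apply: (mulfI (x := 2 * r)); first by rewrite mulf_neq0// pnatr_eq0.
    by move: e1; rewrite ts e2; lra.
  move: f1; rewrite ts f2 => /[swap] <- /(mulIf _).
  by rewrite invr_eq0 gt_eqF// => /(_ isT) /mulfI-> //; rewrite mulf_neq0// pnatr_eq0.
move=> y; split.
  move=> [[Sy ny] yp].
  have yE := expand y; rewrite ny in yE.
  have y1 : c ^+ 2 + dotv e y ^+ 2 + dotv f y ^+ 2 = 1.
    have : dotv y y = 1 by [].
    by rewrite {2}yE !(dotvDr, dotvZr) (dotvC y n) (dotvC y e) (dotvC y f) ny -!expr2.
  have ey : r - dotv e y != 0.
    apply/eqP => h; have er : dotv e y = r by lra.
    have : dotv f y ^+ 2 = 0 by move: y1; rewrite er r2; lra.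
    move/eqP; rewrite sqrf_eq0 => /eqP fy; apply: yp.
    by rewrite yE er fy scale0r addr0 -pE.
  exists (dotv f y / (r - dotv e y)).
  have wE : (1 + (dotv f y / (r - dotv e y)) ^+ 2)^-1 = (r - dotv e y) / (2 * r).
    have -> : 1 + (dotv f y / (r - dotv e y)) ^+ 2 = (2 * r) / (r - dotv e y).
      apply: (mulIf (x := (r - dotv e y) ^+ 2)); first by rewrite expf_neq0.
      have fy2 : dotv f y ^+ 2 = r ^+ 2 - dotv e y ^+ 2 by rewrite r2; lra.
      rewrite mulrDl mul1r expr_div_n mulfVK ?expf_neq0// fy2.
      by field.
    by rewrite invf_div.
  rewrite /chart wE {1}yE {1}pE scalerDr !scalerA -!addrA; congr (_ + _).
  rewrite addrA -scalerDl; congr (_ *: _ + _ *: _); field; rewrite ?rn0 ?ey//.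
move=> [t ->]; have [d1 d2 d3] := dots t.
have t0 : 1 + t ^+ 2 != 0 by rewrite gt_eqF ?chart_den_gt0.
split; first split => //.
  move: (chart _ _ _ _) d1 d2 d3 => w d1 d2 d3.
  rewrite /S2 /= {2}(expand w) !(dotvDr, dotvZr) (dotvC w n) (dotvC w e) (dotvC w f).
  rewrite d1 d2 d3 [c * c](_ : _ = 1 - r ^+ 2); last by rewrite r2; ring.
  by field.
move=> ctp; move: d2; rewrite ctp pE dotvDr !dotvZr (dotvC e n) ne ee => h.
have : 2 * r / (1 + t ^+ 2) = 0 by lra.
by move/eqP; rewrite !mulf_eq0 invr_eq0 (negbTE t0) (negbTE rn0) pnatr_eq0.
Qed.

(** In the chart a half-space is a quadratic inequality, whose leading
    coefficient is the side of the point at infinity. *)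
Lemma chart_side m d p u v t :
  (1 + t ^+ 2) * (dotv m (chart p u v t) - d) =
  (1 + t ^+ 2) * (dotv m p - d) + dotv m u + t * dotv m v.
Proof.
have t0 : 1 + t ^+ 2 != 0 by rewrite gt_eqF ?chart_den_gt0.
by rewrite /chart !(dotvDr, dotvZr); field.
Qed.

(** A quadratic polynomial whose leading coefficient is not positive is
    concave. *)
Lemma chart_disk_interval m d p u v : dotv m p <= d ->
  is_interval [set t | d < dotv m (chart p u v t)].
Proof.
move=> mp x y /= hx hy z /andP[xz zy].
pose q t := (1 + t ^+ 2) * (dotv m p - d) + dotv m u + t * dotv m v.
have side t : (d < dotv m (chart p u v t)) = (0 < q t).
  by rewrite -(pmulr_rgt0 _ (chart_den_gt0 t)) -subr_gt0 -(pmulr_rgt0 _ (chart_den_gt0 t))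
    chart_side -(pmulr_rgt0 _ (chart_den_gt0 t)).
move: hx hy; rewrite !side => qx qy.
have [zx|zNx] := eqVneq z x; first by rewrite zx.
have {}xz : x < z by rewrite lt_neqAle eq_sym zNx.
have yx : 0 < y - x by lra.
rewrite -(pmulr_rgt0 _ yx).
have -> : (y - x) * q z = (y - z) * q x + (z - x) * q y +
    (d - dotv m p) * ((y - x) * ((z - x) * (y - z))) by rewrite /q; ring.
have h1 : 0 <= (y - z) * q x by apply: mulr_ge0; lra.
have h2 : 0 < (z - x) * q y by apply: mulr_gt0; lra.
have h3 : 0 <= (d - dotv m p) * ((y - x) * ((z - x) * (y - z))).
  by rewrite !mulr_ge0//; lra.
lra.
Qed.

Lemma chart_dotv_continuous m p u v : continuous (fun t => dotv m (chart p u v t)).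
Proof.
have -> : (fun t => dotv m (chart p u v t)) =
    (fun t => dotv m p + (1 + t ^+ 2)^-1 * (dotv m u + t * dotv m v)).
  by apply/funext => t; rewrite /chart !(dotvDr, dotvZr).
move=> t; apply: cvgD; first exact: cvg_cst.
apply: cvgM.
  apply: cvgV; first by rewrite gt_eqF ?chart_den_gt0.
  by apply: cvgD; [exact: cvg_cst|exact: exprn_continuous].
by apply: cvgD; [exact: cvg_cst | apply: cvgM; [exact: cvg_id|exact: cvg_cst]].
Qed.

Lemma ray_meets_sphere z v : dotv z z < 1 -> v <> 0 ->
  exists2 s, 0 < s & S2 R (z + s *: v).
Proof.
move=> z1 v0; set a := dotv v v; set b := dotv z v; set k := 1 - dotv z z.
have a0 : 0 < a.
  by rewrite lt_neqAle dotv_ge0 andbT; apply/negP => /eqP/esym/dotv_eq0.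
have k0 : 0 < k by rewrite subr_gt0.
have D0 : 0 < a * k by apply: mulr_gt0.
have D1 : 0 <= b ^+ 2 + a * k by rewrite addr_ge0 ?sqr_ge0 ?ltW.
set q := Num.sqrt (b ^+ 2 + a * k).
have q2 : q ^+ 2 = b ^+ 2 + a * k by rewrite sqr_sqrtr.
have bq : b < q.
  apply: le_lt_trans (ler_norm b) _; rewrite -sqrtr_sqr.
  by have b2 := sqr_ge0 b; rewrite ltr_sqrt; lra.
exists ((q - b) / a); first by apply: divr_gt0; lra.
have an0 : a != 0 by rewrite gt_eqF.
rewrite /S2 /= !(dotvDl, dotvDr, dotvZl, dotvZr) (dotvC v z) -/a -/b.
have -> : dotv z z = 1 - k by rewrite /k; ring.
transitivity (1 - k + (q ^+ 2 - b ^+ 2) / a); first by field.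
by rewrite q2; field.
Qed.

Definition disk n c : set 'rV[R]_3 := S2 R `&` [set x | c < dotv n x].

(** Going from [z] to the sphere in the direction [n + n'] enters both disks. *)
Lemma disjoint_disks_opposite n c n' c' z : plane_params n c -> plane_params n' c' ->
  disk n c `&` disk n' c' = set0 -> dotv z z < 1 -> c <= dotv n z -> c' <= dotv n' z ->
  n' = - n.
Proof.
move=> [nn _] [nn' _] disj z1 nz nz'.
have [/eqP|/eqP v0] := eqVneq (n + n') 0; first by rewrite addrC addr_eq0 => /eqP.
have vv : 0 < dotv (n + n') (n + n').
  by rewrite lt_neqAle dotv_ge0 andbT; apply/negP => /eqP/esym/dotv_eq0.
rewrite !(dotvDl, dotvDr) nn nn' (dotvC n' n) in vv.
have [s s0 Ss] := ray_meets_sphere z1 v0.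
suff : (disk n c `&` disk n' c') (z + s *: (n + n')) by rewrite disj.
have sp : 0 < s * (1 + dotv n n') by apply: mulr_gt0; lra.
split; split => //=; rewrite !(dotvDr, dotvZr) ?nn ?nn' ?(dotvC n' n);
  [move: sp nz | rewrite (addrC (dotv n n')); move: sp nz']; lra.
Qed.

(** The midpoint of two common boundary points is interior to the ball, so the
    first two disks would be the two sides of one plane.  The center of the third
    disk, moved into the ball along its radius, is on one side of this plane; so the
    third disk is opposite to the disk on that side, and shares its center with
    the other one. *)
Lemma tangency_point_unique n c n' c' n'' c'' x y :
  plane_params n c -> plane_params n' c' -> plane_params n'' c'' ->
  disk n c `&` disk n' c' = set0 -> disk n c `&` disk n'' c'' = set0 ->
  disk n' c' `&` disk n'' c'' = set0 -> S2 R x -> S2 R y ->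
  dotv n x = c -> dotv n y = c -> dotv n' x = c' -> dotv n' y = c' -> x = y.
Proof.
move=> P P' P'' d01 d02 d12 Sx Sy nx ny nx' ny'.
apply: contrapT => xy.
have xx : dotv x x = 1 by []. have yy : dotv y y = 1 by [].
have xmy : 0 < dotv (x - y) (x - y).
  rewrite lt_neqAle dotv_ge0 andbT; apply/negP => /eqP/esym/dotv_eq0/eqP.
  by rewrite subr_eq0 => /eqP.
have n'E : n' = - n.
  apply: (disjoint_disks_opposite (z := 2^-1 *: (x + y)) P P' d01).
  - move: xmy; rewrite -scaleN1r !(dotvDl, dotvDr, dotvZl, dotvZr) xx yy (dotvC y x).
    lra.
  - by rewrite !(dotvDr, dotvZr) nx ny; lra.
  - by rewrite !(dotvDr, dotvZr) nx' ny'; lra.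
have [nn /andP[_ c1]] := P; have [_ /andP[_ c1']] := P'.
have [nn'' /andP[c0'' c1'']] := P''.
have c'E : c' = - c by rewrite -nx' n'E dotvNl nx.
(* Interior to the ball and still on the inner side of the third plane, as
   [-1 < c'' < 1]. *)
pose z := ((1 + c'') / 2) *: n''.
have z1 : dotv z z < 1.
  rewrite !(dotvZl, dotvZr) nn'' mulr1.
  have : 0 < (1 + c'') / 2 < 1 by apply/andP; split; lra.
  by move=> /andP[h0 h1]; nra.
have nz'' : c'' <= dotv n'' z by rewrite dotvZr nn''; lra.
have center k a : dotv k k = 1 -> a < 1 -> disk k a k.
  by move=> kk a1; split; rewrite /S2 /= kk.
have [nz|/ltW nz] := leP c (dotv n z).
  have n''E := disjoint_disks_opposite P P'' d02 z1 nz nz''.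
  suff : (disk n' c' `&` disk n'' c'') (- n) by rewrite d12.
  have nnN : dotv (- n) (- n) = 1 by rewrite dotvNl dotvC dotvNl opprK.
  by rewrite n'E n''E; split; apply: center.
have nz' : c' <= dotv n' z by rewrite n'E c'E dotvNl lerN2.
have n''E := disjoint_disks_opposite P' P'' d12 z1 nz' nz''.
rewrite n'E opprK in n''E.
suff : (disk n c `&` disk n'' c'') n by rewrite d02.
by split; [|rewrite n''E]; apply: center.
Qed.

(** In a chart centered at one of the three points, the equation of the second
    circle becomes affine and has two zeros. *)
Lemma circle_sub_of_three (C C' : set 'rV[R]_3) x y z : is_round_circle C ->
  is_round_circle C' -> C x -> C y -> C z -> C' x -> C' y -> C' z ->
  x <> y -> x <> z -> y <> z -> C `<=` C'.
Proof.
move=> [n [c [P ->]]] [n' [c' [P' ->]]] [Sx /= nx] Cy Cz [_ /= nx'] [_ /= ny'] [_ /= nz'].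
move=> xy xz yz.
have [u [v [inj onto]]] := chart_exists P Sx nx.
have [t yE] : exists t, y = chart x u v t by apply/onto; split => // /esym.
have [s zE] : exists s, z = chart x u v s by apply/onto; split => // /esym.
have side := chart_side n' c' x u v.
have ts : t - s != 0.
  by apply/eqP => /eqP; rewrite subr_eq0 => /eqP ts; apply: yz; rewrite yE zE ts.
have := side t; have := side s; rewrite -yE -zE ny' nz' nx' !subrr !mulr0 !add0r => h1 h2.
have v0 : dotv n' v = 0.
  have : (t - s) * dotv n' v = 0 by lra.
  by move/eqP; rewrite mulf_eq0 (negbTE ts) => /eqP.
have u0 : dotv n' u = 0 by move: h1; rewrite v0; lra.
move=> w [Sw /= nw]; split => //=.
have [->//|wx] := pselect (w = x).
have [t' wE] : exists t, w = chart x u v t by apply/onto.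
have := side t'; rewrite -wE u0 v0 nx' subrr !mulr0 !addr0 => /eqP.
by rewrite mulf_eq0 gt_eqF ?chart_den_gt0//= subr_eq0 => /eqP.
Qed.

End SphereGeometry.

(** * The topology of the space of circles *)

Section CircleTopology.
Variable R : realType.
Implicit Types (C : circle R) (n x t : 'rV[R]_3) (c : R).

Lemma circle_inj C C' : circle_set C = circle_set C' -> C = C'.
Proof.
by case: C C' => [C hC] [C' hC'] /= CC'; subst C'; congr Circle; exact: Prop_irrelevance.
Qed.

Lemma circle_S2 C x : circle_set C x -> S2 R x.
Proof. by have [n [c [_ ->]]] := circleP C => -[]. Qed.

(** Continuity of a complex-valued function, read off its two real
    components, so that the algebra takes place in [R]. *)
Definition ccont (X : topologicalType) (f : X -> R[i]) :=
  continuous (fun A => complex.Re (f A)) /\ continuous (fun A => complex.Im (f A)).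

Section Ccont.
Variable X : topologicalType.
Implicit Types f g : X -> R[i].

Lemma ccont_cst (a : R[i]) : ccont (fun _ : X => a).
Proof. by split=> A; exact: cvg_cst. Qed.

Lemma ccontD f g : ccont f -> ccont g -> ccont (fun A => f A + g A).
Proof.
move=> [f1 f2] [g1 g2]; split => A.
- rewrite (_ : (fun A => complex.Re _) = fun A => complex.Re (f A) + complex.Re (g A)).
    by apply: cvgD; [exact: f1|exact: g1].
  by apply/funext => B; case: (f B) (g B) => [? ?] [].
- rewrite (_ : (fun A => complex.Im _) = fun A => complex.Im (f A) + complex.Im (g A)).
    by apply: cvgD; [exact: f2|exact: g2].
  by apply/funext => B; case: (f B) (g B) => [? ?] [].
Qed.

Lemma ccontN f : ccont f -> ccont (fun A => - f A).
Proof.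
move=> [f1 f2]; split => A.
- rewrite (_ : (fun A => complex.Re _) = fun A => - complex.Re (f A)).
    by apply: cvgN; exact: f1.
  by apply/funext => B; case: (f B).
- rewrite (_ : (fun A => complex.Im _) = fun A => - complex.Im (f A)).
    by apply: cvgN; exact: f2.
  by apply/funext => B; case: (f B).
Qed.

Lemma ccontM f g : ccont f -> ccont g -> ccont (fun A => f A * g A).
Proof.
move=> [f1 f2] [g1 g2]; split => A.
- rewrite (_ : (fun A => complex.Re _) = fun A => complex.Re (f A) * complex.Re (g A)
      - complex.Im (f A) * complex.Im (g A)).
    by apply: cvgB; apply: cvgM; [exact: f1|exact: g1|exact: f2|exact: g2].
  by apply/funext => B; case: (f B) (g B) => [? ?] [].
- rewrite (_ : (fun A => complex.Im _) = fun A => complex.Re (f A) * complex.Im (g A)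
      + complex.Im (f A) * complex.Re (g A)).
    by apply: cvgD; apply: cvgM; [exact: f1|exact: g2|exact: f2|exact: g1].
  by apply/funext => B; case: (f B) (g B) => [? ?] [].
Qed.

Lemma ccont_conj f : ccont f -> ccont (fun A => (f A)^*).
Proof.
move=> [f1 f2]; split => A.
- rewrite (_ : (fun A => complex.Re _) = fun A => complex.Re (f A)).
    exact: f1.
  by apply/funext => B; case: (f B).
- rewrite (_ : (fun A => complex.Im _) = fun A => - complex.Im (f A)).
    by apply: cvgN; exact: f2.
  by apply/funext => B; case: (f B).
Qed.

Local Open Scope sesquilinear_scope.

Lemma ccont_conj_action (F G : X -> 'M[R[i]]_2) :
  (forall i j, ccont (fun A => F A i j)) -> (forall i j, ccont (fun A => G A i j)) ->
  forall i j, ccont (fun A => (F A *m G A *m (F A)^t*) i j).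
Proof.
move=> hF hG i j.
rewrite (_ : (fun A => _) = (fun A =>
  (F A i 0 * G A 0 0 + F A i 1 * G A 1 0) * (F A j 0)^* +
  (F A i 0 * G A 0 1 + F A i 1 * G A 1 1) * (F A j 1)^*)); last first.
  by apply/funext => A; rewrite !mx2M !mxE.
by apply: ccontD; (apply: ccontM; last exact/ccont_conj/hF);
  apply: ccontD; apply: ccontM; first [exact: hF | exact: hG].
Qed.

Lemma continuous_herm_time (F : X -> 'M[R[i]]_2) :
  (forall i j, ccont (fun A => F A i j)) -> continuous (fun A => herm_time (F A)).
Proof.
move=> hF.
rewrite (_ : (fun A => _) = fun A => complex.Re (F A 0 0 + F A 1 1) * 2^-1); last first.
  by apply/funext => A; rewrite /herm_time mx2tr.
have [h _] := ccontD (hF 0 0) (hF 1 1).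
by move=> A; apply: cvgM; [exact: h|exact: cvg_cst].
Qed.

Lemma continuous_herm_space (F : X -> 'M[R[i]]_2) k :
  (forall i j, ccont (fun A => F A i j)) ->
  continuous (fun A => herm_space (F A) 0 k).
Proof.
move=> hF.
rewrite (_ : (fun A => _) = fun A => [:: complex.Re (F A 0 1);
    complex.Im (F A 0 1); complex.Re (F A 0 0 - F A 1 1) * 2^-1]`_k); last first.
  by apply/funext => A; rewrite mxE.
case: k => [[|[|[|//]]] hk]; [exact: (hF 0 1).1|exact: (hF 0 1).2|].
have [h _] := ccontD (hF 0 0) (ccontN (hF 1 1)).
by move=> A; apply: cvgM; [exact: h|exact: cvg_cst].
Qed.

Lemma continuous_at_herm_ratio (F : X -> 'M[R[i]]_2) k A :
  (forall i j, ccont (fun A => F A i j)) -> herm_time (F A) != 0 ->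
  {for A, continuous (fun A => (herm_time (F A))^-1 * herm_space (F A) 0 k)}.
Proof.
move=> hF t0; apply: cvgM; last exact: continuous_herm_space.
by apply: cvgV => //; exact: continuous_herm_time.
Qed.

End Ccont.

Local Open Scope sesquilinear_scope.

(** The sign of this function of [A] tells on which side of a plane [A] moves
    [x]; no division occurs in it. *)
Definition side_form n c x (A : 'M[R[i]]_2) :=
  herm_time (hermx (- c) n *m (A *m hermx 1 x *m A^t*)).

Lemma side_formE n c x (A : 'M[R[i]]_2) : \det A = 1 -> dotv x x <= 1 ->
  exists2 s, 0 < s & side_form n c x A = s * (dotv n (act_mx A x) - c).
Proof.
move=> hA hx; exists (herm_time (A *m hermx 1 x *m A^t*)); first exact: herm_time_gt0.
have := act_mxK hA hx; rewrite /side_form; set s := herm_time (A *m _ *m _) => ->.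
by rewrite -scalemxAr herm_timeZ herm_time_hermxM mulr1 [- c + _]addrC.
Qed.

Lemma side_form_continuous (X : topologicalType) (F : X -> 'M[R[i]]_2) n c x :
  (forall i j, ccont (fun A => F A i j)) -> continuous (fun A => side_form n c x (F A)).
Proof.
move=> hF; apply: continuous_herm_time => i j.
have h := ccont_conj_action hF (fun i j => ccont_cst X (hermx 1 x i j)).
rewrite (_ : (fun A => _) = fun A =>
  hermx (- c) n i 0 * (F A *m hermx 1 x *m (F A)^t*) 0 j +
  hermx (- c) n i 1 * (F A *m hermx 1 x *m (F A)^t*) 1 j).
  by apply: ccontD; apply: ccontM; first [exact: ccont_cst | exact: h].
by apply/funext => A; exact: mx2M.
Qed.

Lemma Re_continuous : continuous (fun z : R[i] => complex.Re z).
Proof.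
move=> z U /nbhs_ballP[e /= e0 eU].
apply/nbhs_ballP; exists e%:C%C => /=; first by rewrite ltcR.
move=> w /=; rewrite /ball /= => zw; apply: eU; rewrite /ball /=.
rewrite -ltcR; apply: le_lt_trans zw.
have ReB (x y : R[i]) : complex.Re x - complex.Re y = complex.Re (x - y).
  by case: x y => [? ?] [].
by rewrite ReB; exact: normc_ge_Re.
Qed.

Lemma Im_continuous : continuous (fun z : R[i] => complex.Im z).
Proof.
(* The imaginary part of [z] is the real part of [- i z]. *)
rewrite (_ : (fun z => _) = (fun z : R[i] => complex.Re (- 'i%C * z))); last first.
  by apply/funext => -[a b] /=; ring.
by move=> z; apply: continuous_comp; [exact: mulrl_continuous|exact: Re_continuous].
Qed.

Lemma SL2_ccont i j : ccont (fun A : SL2 R => SL2mx A i j).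
Proof.
have cA : continuous (fun A : SL2 R => SL2mx A i j).
  move=> A; apply: (@continuous_comp (SL2 R) 'M[R[i]]_2 R[i] (@SL2mx R) (fun M => M i j)).
    exact: initial_continuous.
  exact: coord_continuous.
split=> A; apply: (@continuous_comp _ _ _ (fun A : SL2 R => SL2mx A i j)).
- exact: cA.
- exact: Re_continuous.
- exact: cA.
- exact: Im_continuous.
Qed.

Lemma invmx2E (A : 'M[R[i]]_2) : \det A = 1 -> invmx A = \matrix_(i, j)
  if i == 0 then if j == 0 then A 1 1 else - A 0 1
  else if j == 0 then - A 1 0 else A 0 0.
Proof.
move=> hA; have uA : A \in unitmx by rewrite unitmxE hA unitr1.
rewrite mx2det in hA.
set B := (X in _ = X); suff AB : A *m B = 1%:M.
  by rewrite -[RHS](mulKmx uA) AB mulmx1.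
by apply: mx2P; rewrite mx2M !mxE /= -?hA; ring.
Qed.

Lemma SL2_inv_ccont i j : ccont (fun A : SL2 R => invmx (SL2mx A) i j).
Proof.
rewrite (_ : (fun A => _) = (fun A : SL2 R =>
  if i == 0 then if j == 0 then SL2mx A 1 1 else - SL2mx A 0 1
  else if j == 0 then - SL2mx A 1 0 else SL2mx A 0 0)).
  case: (i == 0); case: (j == 0).
  - exact: SL2_ccont.
  - by apply: ccontN; exact: SL2_ccont.
  - by apply: ccontN; exact: SL2_ccont.
  - exact: SL2_ccont.
by apply/funext => A; rewrite invmx2E ?SL2_det// mxE.
Qed.

(** Circles carry a quotient topology of [PSL2], itself a quotient of [SL2], so
    openness may be tested on matrices. *)
Lemma circle_open_SL2 (U : set (circle R)) :
  open [set A : SL2 R | U (circle_act (toPSL2 A) (extended_real_line R))] ->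
  open U.
Proof. by []. Qed.

Lemma circle_act_toPSL2 (A : SL2 R) C y :
  circle_set (circle_act (toPSL2 A) C) y <->
  exists2 x, circle_set C x & act_mx (SL2mx A) x = y.
Proof.
split=> -[x Cx xy]; exists x; [exact: Cx| |exact: Cx|].
  by rewrite -act_toPSL2; exact: xy.
by rewrite -act_toPSL2 in xy; exact: xy.
Qed.

(** A union, over the points [x] of the standard circle, of the conditions that
    the image of [x] lies in the disk. *)
Lemma open_circles_meeting_disk n c :
  open [set C : circle R | C `&` disk n c !=set0].
Proof.
apply: circle_open_SL2.
rewrite (_ : [set A | _] = \bigcup_(x in extended_real_line R)
    [set A : SL2 R | 0 < side_form n c x (SL2mx A)]).
  apply: bigcup_open => x _.
  have cont : continuous (fun A : SL2 R => side_form n c x (SL2mx A)).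
    by apply: side_form_continuous; exact: SL2_ccont.
  exact: (continuousP _).1 cont _ (@open_gt R 0).
apply/seteqP; split => A.
- move=> [y [/circle_act_toPSL2[x Ex <-] [_ cx]]]; exists x; first exact: Ex.
  rewrite /mkset; have [|s s0 ->] := side_formE n c (SL2_det A) (x := x).
    by rewrite (circle_S2 Ex).
  by rewrite pmulr_rgt0// subr_gt0; exact: cx.
- move=> [x Ex]; have Sx := circle_S2 Ex.
  rewrite /mkset; have [|s s0 ->] := side_formE n c (SL2_det A) (x := x).
    by rewrite Sx.
  rewrite pmulr_rgt0// subr_gt0 => cx; exists (act_mx (SL2mx A) x); split.
    by apply/circle_act_toPSL2; exists x; [exact: Ex|].
  by split; [apply: act_mx_S2; [exact: SL2_det|exact: Sx]|exact: cx].
Qed.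

(** The image of the standard circle under [A] avoids [t] when the inverse of
    [A] moves [t] off the standard circle. *)
Lemma open_circles_avoiding_point t : S2 R t ->
  open [set C : circle R | ~ circle_set C t].
Proof.
move=> St; apply: circle_open_SL2.
have t1 : dotv t t <= 1 by rewrite St.
rewrite (_ : [set A | _] =
    [set A : SL2 R | side_form (delta_mx 0 1) 0 t (invmx (SL2mx A)) != 0]).
  have cont : continuous
      (fun A : SL2 R => side_form (delta_mx 0 1) 0 t (invmx (SL2mx A))).
    by apply: side_form_continuous; exact: SL2_inv_ccont.
  exact: (continuousP _).1 cont _ (@open_neq R 0).
apply/seteqP; split => A; rewrite /mkset;
  have hV : \det (invmx (SL2mx A)) = 1 by rewrite det_inv SL2_det invr1.
- move=> Nt; have [s s0 ->] := side_formE (delta_mx 0 1) 0 hV t1.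
  rewrite subr0; apply: mulf_neq0; first by rewrite gt_eqF.
  apply/eqP => h; apply: Nt.
  apply/circle_act_toPSL2; exists (act_mx (invmx (SL2mx A)) t).
    by split; [apply: act_mx_S2; [exact: hV|exact: St]|exact: h].
  by apply: act_mx_VK; [exact: SL2_det|exact: t1].
- move=> + /circle_act_toPSL2[x [Sx ex] xt].
  have [s s0 ->] := side_formE (delta_mx 0 1) 0 hV t1.
  rewrite -xt -act_mxM; [|exact: SL2_det|by rewrite Sx].
  by rewrite mulVmx ?SL2_unit// act_mx1 ex subrr mulr0 eqxx.
Qed.

End CircleTopology.

(** * Circles meeting the complement of a disjoint union of disks *)

(** Distinct connected components are disjoint. *)
Lemma packing_disks (R : realType) (L : set 'rV[R]_3) : circle_packing L ->
  exists (n : nat -> 'rV[R]_3) (c : nat -> R),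
    [/\ forall i, plane_params (n i) (c i),
        forall i j, i <> j -> disk (n i) (c i) `&` disk (n j) (c j) = set0 &
        L = S2 R `\` \bigcup_i disk (n i) (c i)].
Proof.
move=> [D [D_inj D_round LE D_comp]].
have /choice[nc ncP] : forall i, exists nc : 'rV[R]_3 * R,
    plane_params nc.1 nc.2 /\ D i = disk nc.1 nc.2.
  by move=> i; have [n [c [P DE]]] := D_round i; exists (n, c).
have DE : D = fun i => disk (nc i).1 (nc i).2.
  by apply/funext => i; have [_ ->] := ncP i.
exists (fun i => (nc i).1), (fun i => (nc i).2); split.
- by move=> i; have [] := ncP i.
- move=> i j ij; apply/seteqP; split => // x.
  rewrite -[disk _ _]/((fun i => disk (nc i).1 (nc i).2) i) -DE.
  rewrite -[disk _ _]/((fun i => disk (nc i).1 (nc i).2) j) -DE => -[Di Dj].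
  have comp k : exists y, D k = connected_component (S2 R `\` L) y.
    have : range D (D k) by exists k.
    by rewrite D_comp => -[y _ <-]; exists y.
  have [y yE] := comp i; have [z zE] := comp j.
  apply: ij; apply: D_inj => //; rewrite yE zE.
  rewrite yE in Di; rewrite zE in Dj.
  by rewrite (same_connected_component Di) (same_connected_component Dj).
- by rewrite LE DE.
Qed.

Section Packing.
Variables (R : realType) (n : nat -> 'rV[R]_3) (c : nat -> R).
Hypotheses (nc : forall i, plane_params (n i) (c i))
  (disj : forall i j, i <> j -> disk (n i) (c i) `&` disk (n j) (c j) = set0).
Let L := S2 R `\` \bigcup_i disk (n i) (c i).
Implicit Types C : circle R.

Definition hit_disks C : set nat := [set i | C `&` disk (n i) (c i) !=set0].

Definition tangency_point i j : set 'rV[R]_3 := [set x |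
  [/\ S2 R x, dotv (n i) x = c i & dotv (n j) x = c j]].

(** Any other disk of the family serves as the third one. *)
Lemma finite_tangency_points i j : i <> j -> finite_set (tangency_point i j).
Proof.
move=> ij.
have [[x Tx]|T0] := pselect (tangency_point i j !=set0); last first.
  suff -> : tangency_point i j = set0 by exact: finite_set0.
  by apply/seteqP; split => // x Tx; case: T0; exists x.
apply: (@sub_finite_set _ _ [set x]); last exact: finite_set1.
move=> y [Sy iy jy]; have [Sx ix jx] := Tx.
(* An index other than [i] and [j]. *)
pose k := (i + j).+1.
have ik : i <> k by move=> /eqP; rewrite ltn_eqF// /k ltnS leq_addr.
have jk : j <> k by move=> /eqP; rewrite ltn_eqF// /k ltnS leq_addl.
exact: (tangency_point_unique (nc i) (nc j) (nc k) (disj ij) (disj ik) (disj jk)).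
Qed.

Lemma residual_notin_disk x i : L x -> dotv (n i) x <= c i.
Proof.
move=> [Sx Nx]; rewrite leNgt; apply/negP => ix; apply: Nx.
by exists i.
Qed.

(** A point of [C] in the residual set, sent to infinity, turns the rest of [C]
    into a line cut at the other such points. *)
Section Cuts.
Variables (C : circle R) (p : 'rV[R]_3).
Hypotheses (Cp : circle_set C p) (Lp : L p) (CL_fin : finite_set (C `&` L)).

Lemma residual_chart : exists x : R -> 'rV[R]_3,
  let T := [set t | L (x t)] in let J i := [set t | c i < dotv (n i) (x t)] in
  [/\ injective x, x @` T = (C `&` L) `\ p,
      (forall t, circle_set C (x t)) /\ (forall i, continuous (fun t => dotv (n i) (x t))),
      hit_disks C = [set i | J i !=set0] &
      [/\ finite_set T, forall i, open (J i), forall i, is_interval (J i),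
          trivIset setT J & ~` T = \bigcup_i J i]].
Proof.
have [m [d [Pm CE]]] := circleP C.
have [Sp mp] : (S2 R `&` [set x | dotv m x = d]) p by rewrite -CE.
have [u [v [inj onto]]] := chart_exists Pm Sp mp.
exists (chart p u v) => T J.
have S2E t : S2 R (chart p u v t) /\ dotv m (chart p u v t) = d.
  by have [_ /(_ (ex_intro _ t erefl))[]] := onto (chart p u v t).
have Cx t : circle_set C (chart p u v t) by rewrite CE; exact: S2E.
have neq_p t : chart p u v t <> p.
  by have [_ /(_ (ex_intro _ t erefl))[]] := onto (chart p u v t).
have C_onto y : circle_set C y -> y <> p -> exists t, y = chart p u v t.
  by rewrite CE => Cy yp; apply/onto.
have TE : chart p u v @` T = (C `&` L) `\ p.
  apply/seteqP; split => [_ [t Tt <-]|y [[Cy Ly] yp]].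
    by split; [split => //|exact: neq_p].
  by have [t yE] := C_onto y Cy yp; exists t => //; rewrite /T /= -yE.
have cont i : continuous (fun t => dotv (n i) (chart p u v t)).
  exact: chart_dotv_continuous.
split=> //.
  apply/seteqP; split => i [y].
    move=> [Cy [Sy iy]]; have yp : y <> p.
      by move=> yp; have := residual_notin_disk i Lp; rewrite -yp leNgt => /negP; apply.
    by have [t yE] := C_onto y Cy yp; exists t; rewrite /J /= -yE.
  by move=> Jy; exists (chart p u v y); split; [exact: Cx|split; [exact: (S2E y).1|]].
split.
- have <- : finite_set (chart p u v @` T) = finite_set T.
    by apply: eq_finite_set; apply: inj_card_eq => ? ? _ _; exact: inj.
  by rewrite TE; exact: finite_setD.
- move=> i; exact: (continuousP _).1 (cont i) _ (@open_gt R (c i)).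
- by move=> i; apply: chart_disk_interval; exact: residual_notin_disk.
- apply/trivIsetP => i j _ _ /eqP /disj ij; apply/seteqP; split => // t [ti tj].
  suff : (disk (n i) (c i) `&` disk (n j) (c j)) (chart p u v t) by rewrite ij.
  by split; split => //; exact: (S2E t).1.
- apply/seteqP; split => t /=.
    move=> NTt; apply: contrapT => NJ; apply: NTt; split; first exact: (S2E t).1.
    by move=> [i _ [_ ti]]; apply: NJ; exists i.
  by move=> [i _ ti] [_]; apply; exists i => //; split => //; exact: (S2E t).1.
Qed.

Lemma card_hit_disks_cuts m : (((C `&` L) `\ p) #= `I_m)%card ->
  (hit_disks C #= `I_m.+1)%card.
Proof.
have [x [inj TE _ -> [T_fin Jo Ji Jd Jc]]] := residual_chart.
move=> CLm; apply: (cut_card T_fin Jo Ji Jd Jc).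
by rewrite -TE in CLm; apply: card_eq_trans CLm; rewrite card_eq_sym;
  apply: inj_card_eq => ? ? _ _; exact: inj.
Qed.

(** The intervals on both sides of a cut point lie in different disks, and the
    point is a limit of both of them without lying in a disk. *)
Lemma residual_two_disks_cuts y : ((C `&` L) `\ p) y ->
  exists i j, [/\ i <> j, hit_disks C i, hit_disks C j & tangency_point i j y].
Proof.
have [x [inj <- [_ cont] -> [T_fin Jo Ji Jd Jc]]] := residual_chart.
move=> [t Lt <-].
have [i [j [ij it jt]]] := cut_two_sides T_fin Jo Ji Jd Jc Lt.
have bd k : closure [set s | c k < dotv (n k) (x s)] t -> dotv (n k) (x t) = c k.
  move=> kt; apply/eqP; rewrite eq_le residual_notin_disk//= leNgt; apply/negP => lt_k.
  have [|s [/= ks]] := kt [set s | dotv (n k) (x s) < c k].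
    apply: open_nbhs_nbhs; split => //.
    exact: (continuousP _).1 (cont k) _ (@open_lt R (c k)).
  by rewrite ltNge ltW.
have ne k : closure [set s | c k < dotv (n k) (x s)] t ->
    [set s | c k < dotv (n k) (x s)] !=set0.
  by move=> kt; have [s [ks _]] := kt setT filterT; exists s.
exists i, j; split; [exact: ij|exact: ne|exact: ne|].
by split; [exact: Lt.1|exact: bd|exact: bd].
Qed.

End Cuts.

(** Each arc of [C] off the residual set lies in one disk, and different arcs
    lie in different disks. *)
Lemma card_hit_disks C m : (C `&` L #= `I_m.+1)%card -> (hit_disks C #= `I_m.+1)%card.
Proof.
move=> CLm; have CL_fin : finite_set (C `&` L) by apply/finite_setP; exists m.+1.
by have /eq_cardSP[p [Cp Lp] /(card_hit_disks_cuts Cp Lp CL_fin)] := CLm.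
Qed.

(** Any other residual point of [C] can be sent to infinity. *)
Lemma residual_two_disks C m y : (C `&` L #= `I_m.+2)%card -> (C `&` L) y ->
  exists i j, [/\ i <> j, hit_disks C i, hit_disks C j & tangency_point i j y].
Proof.
move=> CLm CLy; have CL_fin : finite_set (C `&` L) by apply/finite_setP; exists m.+2.
have /eq_cardSP[p CLp /eq_cardSP[q [CLq qp] _]] := CLm.
have [yp|yp] := pselect (y = p).
  by apply: (residual_two_disks_cuts CLq.1 CLq.2 CL_fin); split => // yq;
    apply: qp; rewrite /= -yq.
by apply: (residual_two_disks_cuts CLp.1 CLp.2 CL_fin).
Qed.

(** The neighborhood consists of the circles that hit all the disks hit by [C]
    and avoid the tangency points of those disks that are not on [C]. *)
Lemma circle_isolated_among_fewer C k m : (C `&` L #= `I_m)%card ->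
  (3 <= k <= m)%N -> exists U, [/\ open U, U C &
    forall C', U C' -> (C' `&` L #= `I_k)%card -> C' = C].
Proof.
case: k => [|[|[|k]]]//; case: m => // m CLm /andP[_ km].
have Im := card_hit_disks CLm.
have I_fin : finite_set (hit_disks C) by apply/finite_setP; exists m.+1.
pose E := (\bigcup_(i in hit_disks C) \bigcup_(j in hit_disks C `\ i)
  tangency_point i j) `\` C.
have E_fin : finite_set E.
  apply: finite_setD; apply: bigcup_finite => // i _; apply: bigcup_finite.
    exact: finite_setD.
  by move=> j [_ ji]; apply: finite_tangency_points => ij; apply: ji.
pose miss := \bigcup_(i in hit_disks C) ~` [set C' : circle R | hit_disks C' i].
pose through := \bigcup_(t in E) ~` [set C' : circle R | ~ circle_set C' t].
exists (~` (miss `|` through)); split.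
- apply: closed_openC; apply: closedU; apply: closed_bigcup => //.
    by move=> i _; apply: open_closedC; exact: open_circles_meeting_disk.
  move=> t [[i _ [j _ [St _ _]]] _]; apply: open_closedC.
  exact: open_circles_avoiding_point.
- move=> [[i Ci]|[t [_ NCt]]]; first by apply.
  by apply.
- move=> C' /not_orP[Nmiss Nthrough] C'L.
  have sub : hit_disks C `<=` hit_disks C'.
    by move=> i Ci; apply: contrapT => C'i; apply: Nmiss; exists i.
  have Ik := card_hit_disks C'L.
  have I'_fin : finite_set (hit_disks C') by apply/finite_setP; exists k.+3.
  have hitE : hit_disks C = hit_disks C'.
    apply: fset_set_inj => //; apply/eqP; rewrite eqEfcard; apply/andP; split.
      by rewrite -fset_set_sub.
    by rewrite (card_fset_set Im) (card_fset_set Ik).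
  have C'LC : C' `&` L `<=` C.
    move=> y C'Ly; have [i [j [ij]]] := residual_two_disks C'L C'Ly.
    rewrite -hitE => Ci Cj ijy; apply: contrapT => NCy; apply: Nthrough; exists y.
      by split => //; exists i => //; exists j => //; split => // ji; apply: ij.
    by move=> /(_ C'Ly.1).
  have /eq_cardSP[x CLx /eq_cardSP[y [CLy yx] /eq_cardSP[z [[CLz zx] zy] _]]] := C'L.
  have xy : x <> y by move=> xy; apply: yx.
  have xz : x <> z by move=> xz; apply: zx.
  have yz : y <> z by move=> yz; apply: zy.
  apply: circle_inj; apply/seteqP; split.
    by apply: (@circle_sub_of_three _ _ _ x y z (circleP C') (circleP C));
      [exact: CLx.1|exact: CLy.1|exact: CLz.1|exact: C'LC..| | |].
  by apply: (@circle_sub_of_three _ _ _ x y z (circleP C) (circleP C'));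
      [exact: C'LC|exact: C'LC|exact: C'LC|exact: CLx.1|exact: CLy.1|exact: CLz.1| | |].
Qed.

End Packing.

(** * Invariance under the group *)

Section Invariance.
Variables (R : realType) (Gamma : set (PSL2 R)) (o : 'rV[R]_3).
Hypotheses (Gamma_group : subgroup Gamma) (Ho : H3 R o).
Let L := limit_set Gamma o.
Implicit Types (g : PSL2 R) (C : circle R).
Local Open Scope sesquilinear_scope.

Lemma hermx_ccont t i j : ccont (fun x : 'rV[R]_3 => hermx t x i j).
Proof.
rewrite (_ : (fun x => _) = fun x : 'rV[R]_3 => if i == 0 then
    if j == 0 then (t + x 0 2%:R)%:C%C else (x 0 0 +i* x 0 1)%C
    else if j == 0 then (x 0 0 -i* x 0 1)%C else (t - x 0 2%:R)%:C%C); last first.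
  by apply/funext => x; rewrite mxE.
have coord k : continuous (fun x : 'rV[R]_3 => x 0 k) by exact: coord_continuous.
have zero : continuous (fun _ : 'rV[R]_3 => 0 : R) by exact: cst_continuous.
case: (i == 0); case: (j == 0); split => x.
- exact: (cvgD (cvg_cst t) (coord _ x)).
- exact: zero.
- exact: coord.
- exact: coord.
- exact: coord.
- exact: (cvgN (coord _ x)).
- exact: (cvgB (cvg_cst t) (coord _ x)).
- exact: zero.
Qed.

Lemma act_continuous_at g x : dotv x x <= 1 ->
  forall V, nbhs (act g x) V -> nbhs x (act g @^-1` V).
Proof.
move=> hx V [P /= nP PV].
pose H (y : 'rV[R]_3) := SL2mx (ofPSL2 g) *m hermx 1 y *m (SL2mx (ofPSL2 g))^t*.
have Hc i j : ccont (fun y => H y i j).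
  apply: (ccont_conj_action (F := fun=> SL2mx (ofPSL2 g))) => k l.
    exact: ccont_cst.
  exact: hermx_ccont.
have t0 : herm_time (H x) != 0 by rewrite gt_eqF// herm_time_gt0// SL2_det.
have actE j : (fun y => (herm_time (H y))^-1 * herm_space (H y) 0 j) = fun y => act g y 0 j.
  by apply/funext => y; rewrite /act /act_mx [RHS]mxE.
clearbody H.
have coord j : {for x, continuous (fun y => act g y 0 j)}.
  apply: (eq_ind _ (fun f => {for x, continuous f}) _ _ (actE j)).
  exact: continuous_at_herm_ratio.
have nbhsF : Filter (nbhs x) := nbhs_filter x.
have : \forall y \near x, forall i j, P i j (act g y i j).
  apply: (@filter_forall _ _ (fun i y => forall j, P i j (act g y i j)) _ nbhsF) => i.
  apply: (@filter_forall _ _ (fun j y => P i j (act g y i j)) _ nbhsF) => j.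
  rewrite (ord1 i).
  by apply: coord; exact: nP.
by apply: filterS => y Py; exact: PV.
Qed.

(** [g] permutes the orbit of [o] and is continuous at the points of the
    sphere. *)
Lemma limit_set_act g x : Gamma g -> L x -> L (act g x).
Proof.
move=> Gg [cl_x Sx]; split; last exact: act_S2.
have [_ mulG _] := Gamma_group.
have x1 : dotv x x <= 1 by rewrite Sx.
move=> V /(act_continuous_at x1) /cl_x[_ [[h Gh <-] Vh]].
exists (act g (act h o)); split => //.
exists (g * h)%g; first exact: mulG.
by rewrite actM// ltW.
Qed.

Lemma act_invK g x : S2 R x -> act g (act (g^-1)%g x) = x.
Proof. by move=> Sx; rewrite -actM ?mulgV ?act1// Sx. Qed.

Lemma act_Kinv g x : S2 R x -> act (g^-1)%g (act g x) = x.
Proof. by move=> Sx; rewrite -actM ?mulVg ?act1// Sx. Qed.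

Lemma circles_meeting_act g k C : Gamma g -> circles_meeting L k C ->
  circles_meeting L k (circle_act g C).
Proof.
move=> Gg; have [_ _ invG] := Gamma_group; rewrite /circles_meeting /mkset => CLk.
rewrite (_ : circle_act g C `&` L = act g @` (C `&` L)).
  apply: card_eq_trans CLk; apply: inj_card_eq => x y /set_mem[Cx _] /set_mem[Cy _] xy.
  apply: (etrans (esym (act_Kinv g (circle_S2 Cx)))).
  exact: (etrans (congr1 (act (g^-1)%g) xy) (act_Kinv g (circle_S2 Cy))).
apply/seteqP; split => y.
  move=> [[x Cx <-] Lx]; exists x; [split; first exact: Cx | exact: erefl].
  have := limit_set_act (invG _ Gg) Lx.
  by rewrite -[act_mx _ x]/(act g x) (act_Kinv g (circle_S2 Cx)).
move=> [x [Cx Lx] <-]; split; last exact: limit_set_act.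
by exists x; [exact: Cx|exact: erefl].
Qed.

Lemma circle_act_invK g C : circle_act g (circle_act (g^-1)%g C) = C.
Proof.
apply: circle_inj; apply/seteqP; split => x.
  by move=> [_ [y Cy <-] <-]; have := act_invK g (circle_S2 Cy); rewrite /act => ->.
move=> Cx; exists (act (g^-1)%g x); last exact: act_invK (circle_S2 Cx).
by exists x.
Qed.

Lemma circles_meeting_invariant g k : Gamma g ->
  circle_act g @` circles_meeting L k = circles_meeting L k.
Proof.
move=> Gg; have [_ _ invG] := Gamma_group.
apply/seteqP; split => [_ [C BC <-]|C BC]; first exact: circles_meeting_act.
by exists (circle_act (g^-1)%g C); [apply: circles_meeting_act => //; exact: invG|
  exact: circle_act_invK].
Qed.

End Invariance.

(** * Discreteness and accumulation *)

Theorem proposition1 (R : realType) (Gamma : set (PSL2 R)) (o : 'rV[R]_3)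
    (k : nat) :
  H3 R o ->
  kleinian Gamma ->
  torsion_free Gamma ->
  geometrically_finite Gamma ->
  circle_packing (limit_set Gamma o) ->
  (3 <= k)%N ->
  let L := limit_set Gamma o in
  let B := circles_meeting L k in
  [/\ B `<=` isolated B,
      forall g, Gamma g -> circle_act g @` B = B &
      forall C : circle R, finite_set (C `&` L) -> accumulation_point B C ->
        exists2 m, (m < k)%N & (C `&` L #= `I_m)%card].
Proof.
move=> Ho [Gamma_group _] _ _ packing k3 L B.
have [n [c [nc disj LE]]] := packing_disks packing.
have isolation (C : circle R) m : (C `&` L #= `I_m)%card -> (k <= m)%N ->
    exists U : set (circle R), [/\ open U, U C & forall C', U C' -> B C' -> C' = C].
  move=> CLm km; rewrite /L LE in CLm.
  have [|U [Uo UC UB]] := circle_isolated_among_fewer nc disj CLm (k := k).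
    by rewrite k3.
  by exists U; split => // C' UC' BC'; apply: UB => //; rewrite -LE.
split.
- move=> C BC; have [//|U [Uo UC UB]] := isolation C k BC.
  split; first exact: mem_set.
  exists U; first exact: open_nbhs_nbhs.
  by apply/seteqP; split => [C' [UC' BC']|_ ->]; [exact: UB|].
- by move=> g Gg; exact: circles_meeting_invariant.
- move=> C /finite_setP[m CLm] [u [uB uC]]; exists m => //.
  rewrite ltnNge; apply/negP => km.
  have [U [Uo UC UB]] := isolation C m CLm km.
  have [N _ /(_ N (leqnn N)) UN] := uC U (open_nbhs_nbhs (conj Uo UC)).
  by have [BN] := uB N; apply; exact: UB.
Qed.
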